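(* Let $p,n\ge1$ be integers, $h=1/n$ and $\mathcal{D}=\{0,1\}$. The discrete Fourier functions $F_1,\dots,F_{n_{reg}}$, restricted to $[0,1]$, form a basis of eigenfunctions for the mass and stiffness operators on the space $S_{p,h,\{0,1\}}^{reg}$. That is, they form a basis of $S_{p,h,\{0,1\}}^{reg}$ and for all $i\neq j$ in $\{1,\dots,n_{reg}\}$ $$\int_0^1F_i(x)F_j(x)\,dx=0\qquad\text{and}\qquad\int_0^1F_i'(x)F_j'(x)\,dx=0$$ (equivalently, they form a basis and for each $j$ there is $\lambda_j\in\mathbb{R}$ with $\int_0^1F_j'v'\,dx=\lambda_j\int_0^1F_jv\,dx$ for all $v\in S_{p,h,\{0,1\}}^{reg}$, the $F_j$ being pairwise $L^2(0,1)$-orthogonal).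
   Context: $\pi_p$ denotes polynomials of degree at most $p$. $S_{p,h,\{0,1\}}=\{v\in C^{p-1}[0,1]: v|_{[(k-1)h,kh]}\in\pi_p,\ k=1,\dots,n,\ v(0)=v(1)=0\}$ and $$S_{p,h,\{0,1\}}^{reg}=\{v\in S_{p,h,\{0,1\}}:\partial^{2k}v(0)=\partial^{2k}v(1)=0\text{ for }k=1,\dots,\lfloor\tfrac{p-1}2\rfloor\}.$$ Its dimension is $n_{reg}=n-1$ if $p$ is odd and $n_{reg}=n$ if $p$ is even. Periodic splines on $(-2,2)$: $S^{per}_{p,h}$ is the set of $v\in C^{p-1}[-2,2]$ with $v|_{(ih,(i+1)h)}\in\pi_p$ for $i=-2n,\dots,2n-1$ and $\partial^jv(-2)=\partial^jv(2)$ for $j=0,\dots,p-1$; its dimension is $4n$. Nodes: for $i=-2n+1,\dots,2n$, $x_i=ih$ if $p$ is odd and $x_i=(i-\frac12)h$ if $p$ is even. The Lagrange basis functions $L_j\in S^{per}_{p,h}$, $j=-2n+1,\dots,2n$, are determined by $L_j(x_i)=\delta_{i,j}$ for $i=-2n+1,\dots,2n$ (they exist and are unique). Discrete Fourier functions: with $\alpha_j=j\pi$, $$F_j(x)=\sum_{i=-2n+1}^{2n}\sin(x_i\alpha_j)\,L_i(x),\qquad j=1,\dots,n_{reg}.$$ *)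

(* Defs.v *)
From Stdlib Require Import Reals ZArith Arith.
From Coquelicot Require Import Coquelicot.
Open Scope R_scope.

Definition seg (a b x : R) : Prop := a <= x <= b.

(* [d 0, ..., d k] are the successive derivatives of [v] on the closed interval
   [a, b] (one-sided at [a] and [b]), and [d k] is continuous there.  Only the
   values of [v] on [a, b] matter, and for a < b the values of
   [d 0, ..., d k] on [a, b] are uniquely determined by [v]. *)
Definition derivs_on (a b : R) (k : nat) (v : R -> R) (d : nat -> R -> R) : Prop :=
  (forall x, seg a b x -> d 0%nat x = v x) /\
  (forall j x, (j < k)%nat -> seg a b x -> D_in (d j) (d (S j)) (seg a b) x) /\
  (forall x, seg a b x -> continue_in (d k) (seg a b) x).

Definition Ck_on (a b : R) (k : nat) (v : R -> R) : Prop :=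
  exists d, derivs_on a b k v d.

(* Polynomial functions of degree at most [p]; [sum_f_R0 f p] is f 0 + ... + f p. *)
Definition poly_le (p : nat) (q : R -> R) : Prop :=
  exists c : nat -> R, forall x, q x = sum_f_R0 (fun i => c i * x ^ i) p.

Definition mesh (n : nat) : R := 1 / INR n.

(* Functions on [0, 1] (resp. [-2, 2]) are represented by total functions
   [R -> R] whose values outside the interval are irrelevant. *)

Definition spline0 (p n : nat) (v : R -> R) : Prop :=
  Ck_on 0 1 (p - 1) v /\
  (forall k : nat, (1 <= k <= n)%nat ->
     exists q, poly_le p q /\
       forall x, seg (INR (k - 1) * mesh n) (INR k * mesh n) x -> v x = q x) /\
  v 0 = 0 /\ v 1 = 0.

Definition spline_reg (p n : nat) (v : R -> R) : Prop :=
  spline0 p n v /\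
  exists d, derivs_on 0 1 (p - 1) v d /\
    forall k : nat, (1 <= k <= (p - 1) / 2)%nat ->
      d (2 * k)%nat 0 = 0 /\ d (2 * k)%nat 1 = 0.

Definition nreg (p n : nat) : nat := if Nat.odd p then (n - 1)%nat else n.

Definition spline_per (p n : nat) (v : R -> R) : Prop :=
  (exists d, derivs_on (-2) 2 (p - 1) v d /\
     forall j : nat, (j <= p - 1)%nat -> d j (-2) = d j 2) /\
  forall i : Z, (- 2 * Z.of_nat n <= i <= 2 * Z.of_nat n - 1)%Z ->
    exists q, poly_le p q /\
      forall x, IZR i * mesh n < x < IZR (i + 1) * mesh n -> v x = q x.

Definition node (p n : nat) (i : Z) : R :=
  if Nat.odd p then IZR i * mesh n else (IZR i - 1 / 2) * mesh n.

Definition node_index (n : nat) (i : Z) : Prop :=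
  (- 2 * Z.of_nat n + 1 <= i <= 2 * Z.of_nat n)%Z.

(* The family of Lagrange basis functions exists and is unique on [-2, 2]. *)
Definition lagrange_basis (p n : nat) (L : Z -> R -> R) : Prop :=
  forall j, node_index n j ->
    spline_per p n (L j) /\
    forall i, node_index n i -> L j (node p n i) = if Z.eqb i j then 1 else 0.

(* The index i = -2n+1, ..., 2n is written i = m - 2n with m = 1, ..., 4n. *)
Definition fourier (p n : nat) (L : Z -> R -> R) (j : nat) (x : R) : R :=
  sum_n_m (fun m : nat =>
             let i := (Z.of_nat m - 2 * Z.of_nat n)%Z in
             sin (node p n i * (INR j * PI)) * L i x)
          1 (4 * n).

(* The restrictions to [a, b] of [e 1, ..., e m] form a basis of the space [S]
   of functions on [a, b]. *)
Definition basis_on (a b : R) (S : (R -> R) -> Prop) (m : nat)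
    (e : nat -> R -> R) : Prop :=
  (forall j, (1 <= j <= m)%nat -> S (e j)) /\
  (forall c : nat -> R,
     (forall x, seg a b x -> sum_n_m (fun j => c j * e j x) 1 m = 0) ->
     forall j, (1 <= j <= m)%nat -> c j = 0) /\
  (forall v, S v ->
     exists c : nat -> R,
       forall x, seg a b x -> v x = sum_n_m (fun j => c j * e j x) 1 m).

(* L2(0,1) product (mass form) and H1 semi-product (stiffness form).  For
   splines the integrands are piecewise polynomial except at finitely many
   points (knots where the derivative may jump, when p = 1, and the end
   points), which do not affect [RInt]. *)
Definition mass (f g : R -> R) : R := RInt (fun x => f x * g x) 0 1.

Definition stiffness (f g : R -> R) : R :=
  RInt (fun x => Derive f x * Derive g x) 0 1.

(* Main.v *)
Require Import Defs.
From Stdlib Require Import Reals ZArith Arith Lra Lia IndefiniteDescription.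
From Coquelicot Require Import Coquelicot.
Open Scope R_scope.

(* Extend everything to 4-periodic splines on the line.  The [4n] Lagrange
   functions are as many as the dimension of the periodic splines, so a periodic
   spline is determined by its values at the nodes.  Hence each identity of
   [sin (j pi x)] that survives on the nodes passes to [F j]: it is odd,
   2-periodic, and [F j (x + h) + F j (x - h) = 2 cos (j pi h) F j x].  The
   operator on the left is symmetric on 2-periodic functions for both the mass
   and the stiffness form, and the values [2 cos (j pi h)] are distinct for
   j = 1, ..., nreg, which gives both orthogonality relations.  The odd
   2-periodic extension of a reduced spline is a periodic spline determined by
   its values at [nreg] nodes, so the [F j] span; in the orthogonal basis [F j]
   both forms are diagonal. *)

(** * Finite sums and linear dependence *)

(** A spline is recorded by one number per knot [t]: the coefficient of [(x - t) ^ p] by which its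
    right piece exceeds its left piece. These jumps are linear in the spline and behave simply under
    translation and reflection, so higher derivatives are needed only in passing between a bounded
    interval and the line. Reflection explains the reduced space. A graph and its half-turn about
    (t, 0) always have equal odd derivatives at t, so the odd extension stays C^(p-1) at 0 and 1
    exactly when the even derivatives of order below p vanish there. The eigenvalues are distinct
    because j <= n keeps the angles j pi h in [0, pi], where cos is injective. No [F j] with j <=
    nreg vanishes, since sin(j pi x) is positive at the first positive node. For p = 1 the
    derivative of a spline jumps at the knots, so the stiffness half rests on identities that hold
    only off the knots; integrals have to be compared under that weaker agreement. *)

Definition sum1 (f : nat -> R) (m : nat) : R := sum_n_m f 1 m.

Definition lin (m : nat) (b : nat -> R) (f : nat -> R -> R) (x : R) : R :=
  sum1 (fun j => b j * f j x) m.

Lemma sum1_0 (f : nat -> R) : sum1 f 0 = 0.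
Proof. unfold sum1. rewrite sum_n_m_zero; [reflexivity | lia]. Qed.

Lemma sum1_S (f : nat -> R) m : sum1 f (S m) = sum1 f m + f (S m).
Proof. unfold sum1. rewrite sum_n_Sm; [reflexivity | lia]. Qed.

Lemma sum1_ext (f g : nat -> R) m :
  (forall j, (1 <= j <= m)%nat -> f j = g j) -> sum1 f m = sum1 g m.
Proof. intros H. apply sum_n_m_ext_loc. exact H. Qed.

Lemma sum1_zero (f : nat -> R) m :
  (forall j, (1 <= j <= m)%nat -> f j = 0) -> sum1 f m = 0.
Proof.
  induction m as [|m IH]; intros H; [apply sum1_0|].
  rewrite sum1_S, IH, H; [ring | lia | intros; apply H; lia].
Qed.

Lemma sum1_single (f : nat -> R) m k :
  (1 <= k <= m)%nat -> (forall j, (1 <= j <= m)%nat -> j <> k -> f j = 0) ->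
  sum1 f m = f k.
Proof.
  induction m as [|m IH]; intros Hk H; [lia|].
  rewrite sum1_S. destruct (Nat.eq_dec k (S m)) as [->|Hne].
  - rewrite sum1_zero; [ring | intros; apply H; lia].
  - rewrite IH, (H (S m)); [ring | lia | lia | lia | intros; apply H; lia].
Qed.

Lemma sum1_plus (f g : nat -> R) m :
  sum1 (fun j => f j + g j) m = sum1 f m + sum1 g m.
Proof.
  induction m as [|m IH]; [rewrite !sum1_0; ring | rewrite !sum1_S, IH; ring].
Qed.

Lemma sum1_scal (a : R) (f : nat -> R) m :
  sum1 (fun j => a * f j) m = a * sum1 f m.
Proof.
  induction m as [|m IH]; [rewrite !sum1_0; ring | rewrite !sum1_S, IH; ring].
Qed.

(** [A j i] is coordinate [i] of vector [j]. Gaussian elimination: if the last vector has a nonzero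
    coordinate [i0], it is used to clear and drop that coordinate in the others; otherwise the last
    vector is zero and is a relation by itself. *)
Lemma linear_dependence (m : nat) : forall A : nat -> nat -> R,
  exists b : nat -> R,
    (exists j, (1 <= j <= S m)%nat /\ b j <> 0) /\
    forall i, (1 <= i <= m)%nat -> sum1 (fun j => b j * A j i) (S m) = 0.
Proof.
  induction m as [|m IH]; intros A.
  - exists (fun _ => 1). split; [exists 1%nat; split; [lia | lra] | intros; lia].
  - set (a := A (S (S m))).
    destruct (Classical_Prop.classic (exists i, (1 <= i <= S m)%nat /\ a i <> 0))
      as [[i0 [Hi0 Ha]]|Hno].
    (* [bump] enumerates the coordinates other than [i0]. *)
    + pose (bump := fun i => if (i <? i0)%nat then i else S i).
      destruct (IH (fun j i => A j (bump i) - A j i0 / a i0 * a (bump i)))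
        as [b [[j0 [Hj0 Hb0]] Hb]].
      pose (s := sum1 (fun j => b j * A j i0) (S m)).
      (* The last coefficient is the one that cancels coordinate [i0]; on the other coordinates it
         reproduces the relation among the eliminated vectors. *)
      exists (fun j => if Nat.eq_dec j (S (S m)) then - s / a i0 else b j).
      assert (Hsum : forall i,
        sum1 (fun j => (if Nat.eq_dec j (S (S m)) then - s / a i0 else b j) * A j i) (S (S m)) = sum1 (fun j => b j * A j i) (S m) - s / a i0 * a i).
      { intros i. rewrite sum1_S. destruct (Nat.eq_dec (S (S m)) (S (S m))); [|lia].
        fold a. rewrite (sum1_ext _ (fun j => b j * A j i)); [unfold a; field; exact Ha|].
        intros j Hj. destruct (Nat.eq_dec j (S (S m))); [lia | ring]. }
      split.
      * exists j0. split; [lia|]. destruct (Nat.eq_dec j0 (S (S m))); [lia | exact Hb0].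
      * intros i Hi. rewrite Hsum.
        destruct (Nat.eq_dec i i0) as [->|Hne]; [fold s; field; exact Ha|].
        assert (exists i', (1 <= i' <= m)%nat /\ bump i' = i) as [i' [Hi' <-]].
        { destruct (Nat.lt_ge_cases i i0).
          - exists i. split; [lia|]. unfold bump. destruct (Nat.ltb_spec i i0); lia.
          - exists (pred i). split; [lia|]. unfold bump.
            destruct (Nat.ltb_spec (pred i) i0); lia. }
        specialize (Hb i' Hi').
        rewrite (sum1_ext _ (fun j => b j * A j (bump i') +
          (- a (bump i') / a i0) * (b j * A j i0))) in Hb; [|intros; field; exact Ha].
        rewrite sum1_plus, sum1_scal in Hb. fold s in Hb. rewrite <- Hb. field; exact Ha.
    + exists (fun j => if Nat.eq_dec j (S (S m)) then 1 else 0). split.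
      * exists (S (S m)). split; [lia|].
        destruct (Nat.eq_dec (S (S m)) (S (S m))); [lra | lia].
      * intros i Hi. rewrite sum1_zero; [reflexivity|]. intros j Hj.
        destruct (Nat.eq_dec j (S (S m))) as [->|]; [|ring].
        destruct (Req_dec (a i) 0) as [E|E]; [fold a; rewrite E; ring|].
        elim Hno. exists i. auto.
Qed.

(** * Polynomial functions *)

Lemma poly_le_ext p q r : poly_le p q -> (forall x, r x = q x) -> poly_le p r.
Proof. intros [c Hc] H. exists c. intros x. rewrite H. apply Hc. Qed.

Lemma poly_le_0 q : poly_le 0 q <-> exists a, forall x, q x = a.
Proof.
  split.
  - intros [c H]. exists (c 0%nat). intros x. rewrite H. simpl. ring.
  - intros [a H]. exists (fun _ => a). intros x. rewrite H. simpl. ring.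
Qed.

Lemma poly_le_S p q :
  poly_le (S p) q <-> exists a r, poly_le p r /\ forall x, q x = r x + a * x ^ S p.
Proof.
  split.
  - intros [c H]. exists (c (S p)), (fun x => sum_f_R0 (fun i => c i * x ^ i) p).
    split; [exists c; reflexivity | exact H].
  - intros [a [r [[c Hc] H]]]. exists (fun i => if Nat.eq_dec i (S p) then a else c i).
    intros x. rewrite H, Hc, tech5. destruct (Nat.eq_dec (S p) (S p)); [|lia].
    f_equal. apply sum_eq. intros i Hi. destruct (Nat.eq_dec i (S p)); [lia | reflexivity].
Qed.

Lemma poly_le_plus p q r : poly_le p q -> poly_le p r -> poly_le p (fun x => q x + r x).
Proof.
  intros [c Hc] [d Hd]. exists (fun i => c i + d i). intros x.
  rewrite Hc, Hd, <- sum_plus. apply sum_eq. intros; ring.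
Qed.

Lemma poly_le_scal p a q : poly_le p q -> poly_le p (fun x => a * q x).
Proof.
  intros [c Hc]. exists (fun i => a * c i). intros x.
  rewrite Hc, scal_sum. apply sum_eq. intros; ring.
Qed.

Lemma poly_le_mono p p' q : (p <= p')%nat -> poly_le p q -> poly_le p' q.
Proof.
  induction 1 as [|p' _ IH]; intros Hq; [exact Hq|].
  apply poly_le_S. exists 0, q. split; [auto | intros; ring].
Qed.

Lemma poly_le_const p a : poly_le p (fun _ => a).
Proof. apply (poly_le_mono 0); [lia|]. apply poly_le_0. exists a. reflexivity. Qed.

Lemma poly_le_mulx p q : poly_le p q -> poly_le (S p) (fun x => x * q x).
Proof.
  revert q. induction p as [|p IH]; intros q Hq.
  - apply poly_le_0 in Hq. destruct Hq as [a Ha]. apply poly_le_S.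
    exists a, (fun _ => 0). split; [apply poly_le_const | intros; rewrite Ha; simpl; ring].
  - apply poly_le_S in Hq. destruct Hq as [a [r [Hr Hq]]]. apply poly_le_S.
    exists a, (fun x => x * r x). split; [auto | intros; rewrite Hq; simpl; ring].
Qed.

Lemma poly_le_pow_affine p a b : poly_le p (fun x => (a * x + b) ^ p).
Proof.
  induction p as [|p IH]; [apply poly_le_0; exists 1; reflexivity|].
  apply poly_le_ext with
    (fun x => a * (x * (a * x + b) ^ p) + b * (a * x + b) ^ p); [|intros; simpl; ring].
  apply poly_le_plus; apply poly_le_scal; [now apply poly_le_mulx|].
  now apply (poly_le_mono p); [lia|].
Qed.

Lemma poly_le_affine p q a b : poly_le p q -> poly_le p (fun x => q (a * x + b)).
Proof.
  revert q. induction p as [|p IH]; intros q Hq.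
  - apply poly_le_0 in Hq. destruct Hq as [e He]. apply poly_le_0. exists e. auto.
  - apply poly_le_S in Hq. destruct Hq as [e [r [Hr Hq]]].
    apply poly_le_ext with (fun x => r (a * x + b) + e * (a * x + b) ^ S p); [|auto].
    apply poly_le_plus; [apply (poly_le_mono p); [lia | auto]|].
    apply poly_le_scal, poly_le_pow_affine.
Qed.

Lemma is_derive_pow_shift p t x :
  is_derive (fun y => (y - t) ^ S p) x (INR (S p) * (x - t) ^ p).
Proof.
  replace (INR (S p) * (x - t) ^ p) with (INR (S p) * 1 * (x - t) ^ pred (S p))
    by (simpl pred; ring).
  apply (is_derive_pow (fun y => y - t)). auto_derive; [trivial | ring].
Qed.

Lemma poly_le_is_derive p q : poly_le p q ->
  exists q', poly_le (pred p) q' /\ forall x, is_derive q x (q' x).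
Proof.
  revert q. induction p as [|p IH]; intros q Hq.
  - apply poly_le_0 in Hq. destruct Hq as [a Ha]. exists (fun _ => 0). split.
    + apply poly_le_const.
    + intros x. apply is_derive_ext with (fun _ => a); [auto | apply @is_derive_const].
  - apply poly_le_S in Hq. destruct Hq as [a [r [Hr Hq]]].
    destruct (IH r Hr) as [r' [Hr' Hd]].
    exists (fun x => r' x + a * INR (S p) * (1 * x + 0) ^ p). split.
    + apply poly_le_plus; [apply (poly_le_mono (pred p)); [lia | auto]|].
      apply poly_le_scal, poly_le_pow_affine.
    + intros x. apply is_derive_ext with (fun x => r x + a * x ^ S p); [auto|].
      apply @is_derive_plus; [apply Hd|].
      rewrite Rmult_1_l, Rplus_0_r, Rmult_assoc. apply is_derive_scal.
      pose proof (is_derive_pow_shift p 0 x) as H. rewrite Rminus_0_r in H.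
      revert H. apply is_derive_ext. intros y. now rewrite Rminus_0_r.
Qed.

Lemma poly_ex_derive p q x : poly_le p q -> ex_derive q x.
Proof. intros Hq. destruct (poly_le_is_derive p q Hq) as [q' [_ H]]. exists (q' x). auto. Qed.

Lemma poly_continuous p q x : poly_le p q -> continuous q x.
Proof. intros Hq. apply (@ex_derive_continuous R_AbsRing R_NormedModule). now apply (poly_ex_derive p). Qed.

Lemma poly_Derive p q : poly_le p q -> poly_le (pred p) (Derive q).
Proof.
  intros Hq. destruct (poly_le_is_derive p q Hq) as [q' [H' H]].
  apply poly_le_ext with q'; [auto|]. intros x. now apply is_derive_unique.
Qed.

Lemma poly_Derive_n p q j : poly_le p q -> poly_le (p - j) (Derive_n q j).
Proof.
  intros Hq. induction j as [|j IH]; [now rewrite Nat.sub_0_r|].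
  replace (p - S j)%nat with (pred (p - j)) by lia. now apply poly_Derive.
Qed.

Lemma poly_ex_derive_n p q j x : poly_le p q -> ex_derive_n q j x.
Proof.
  intros Hq. destruct j as [|j]; [exact I|]. simpl.
  apply (poly_ex_derive (p - j)). now apply poly_Derive_n.
Qed.

Lemma derive_zero_const (f : R -> R) :
  (forall x, is_derive f x 0) -> forall x y, f x = f y.
Proof.
  intros H. assert (Hlt : forall x y, x < y -> f x = f y).
  { intros x y Hxy. apply (eq_is_derive f x y); [intros; apply H | exact Hxy]. }
  intros x y. destruct (Rtotal_order x y) as [Hl|[->|Hg]]; auto. symmetry; auto.
Qed.

Lemma poly_Derive_zero p q :
  poly_le p q -> (forall x, Derive q x = 0) -> forall x y, q x = q y.
Proof.
  intros Hq H. apply derive_zero_const. intros x. rewrite <- (H x).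
  apply Derive_correct. now apply (poly_ex_derive p).
Qed.

Lemma locally_Ioo a b x (P : R -> Prop) :
  a < x < b -> (forall y, a < y < b -> P y) -> locally x P.
Proof.
  intros Hx H. assert (He : 0 < Rmin (x - a) (b - x)) by (apply Rmin_case; lra).
  exists (mkposreal _ He). intros y Hy. apply H.
  change (Rabs (y - x) < Rmin (x - a) (b - x)) in Hy.
  pose proof (Rmin_l (x - a) (b - x)). pose proof (Rmin_r (x - a) (b - x)).
  apply Rabs_def2 in Hy. lra.
Qed.

(** Induction on the degree: the derivative vanishes on the interval, hence everywhere, so [q] is
    constant and equals its value at the midpoint. *)
Lemma poly_zero p q a b :
  poly_le p q -> a < b -> (forall x, a < x < b -> q x = 0) -> forall x, q x = 0.
Proof.
  revert q. induction p as [|p IH]; intros q Hq Hab H x.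
  - apply poly_le_0 in Hq. destruct Hq as [e He].
    rewrite He, <- (He ((a + b) / 2)). apply H. lra.
  - rewrite <- (H ((a + b) / 2)) by lra. apply (poly_Derive_zero (S p)); [exact Hq|].
    apply IH; [now apply (poly_Derive (S p)) | exact Hab|].
    intros y Hy. rewrite (Derive_ext_loc q (fun _ => 0)); [apply Derive_const|].
    now apply (locally_Ioo a b).
Qed.

Lemma poly_eq p q r a b :
  poly_le p q -> poly_le p r -> a < b -> (forall x, a < x < b -> q x = r x) ->
  forall x, q x = r x.
Proof.
  intros Hq Hr Hab H x.
  enough (q x + -1 * r x = 0) by lra.
  apply (poly_zero p (fun x => q x + -1 * r x) a b); [|exact Hab|].
  - apply poly_le_plus; [|apply poly_le_scal]; assumption.
  - intros y Hy. rewrite H by exact Hy. ring.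
Qed.

(** Only the top term of the Taylor expansion at [t] survives. By induction [Derive r] is
    [c * (x - t) ^ p]; subtracting its primitive from [r] leaves a constant that is zero at [t]. *)
Lemma poly_flat p r t :
  poly_le p r -> (forall j, (j < p)%nat -> Derive_n r j t = 0) ->
  exists c, forall x, r x = c * (x - t) ^ p.
Proof.
  revert r. induction p as [|p IH]; intros r Hr H.
  - apply poly_le_0 in Hr. destruct Hr as [a Ha]. exists a. intros; rewrite Ha; simpl; ring.
  - destruct (IH (Derive r)) as [c Hc].
    + now apply (poly_Derive (S p)).
    + intros j Hj. change (Derive r) with (Derive_n r 1). rewrite Derive_n_comp.
      replace (j + 1)%nat with (S j) by lia. apply H. lia.
    + assert (Hne : INR (S p) <> 0) by (apply not_0_INR; lia).
      exists (c / INR (S p)).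
      assert (Hd : forall x, is_derive (fun x => r x - c / INR (S p) * (x - t) ^ S p) x 0).
      { intros x. replace 0 with (c * (x - t) ^ p - c * (x - t) ^ p) by ring.
        apply @is_derive_minus.
        - rewrite <- Hc. apply Derive_correct. now apply (poly_ex_derive (S p)).
        - replace (c * (x - t) ^ p) with (c / INR (S p) * (INR (S p) * (x - t) ^ p))
            by (field; exact Hne).
          apply is_derive_scal, is_derive_pow_shift. }
      intros x. pose proof (derive_zero_const _ Hd x t) as E. simpl in E.
      specialize (H 0%nat ltac:(lia)). simpl in H. rewrite H in E.
      rewrite Rminus_diag in E. simpl. lra.
Qed.

Lemma poly_Derive_n_minus p q r j x : poly_le p q -> poly_le p r ->
  Derive_n (fun y => q y - r y) j x = Derive_n q j x - Derive_n r j x.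
Proof.
  intros Hq Hr. apply Derive_n_minus; apply filter_forall; intros y k _;
  now apply (poly_ex_derive_n p).
Qed.

Lemma poly_glue p q1 q2 t :
  poly_le p q1 -> poly_le p q2 ->
  (forall j, (j < p)%nat -> Derive_n q1 j t = Derive_n q2 j t) ->
  exists c, forall x, q2 x = q1 x + c * (x - t) ^ p.
Proof.
  intros H1 H2 H. destruct (poly_flat p (fun x => q2 x - q1 x) t) as [c Hc].
  - apply poly_le_ext with (fun x => q2 x + -1 * q1 x); [|intros; ring].
    apply poly_le_plus; [|apply poly_le_scal]; assumption.
  - intros j Hj. rewrite (poly_Derive_n_minus p), H; auto; ring.
  - exists c. intros x. rewrite <- Hc. ring.
Qed.

Lemma poly_Derive_n_reflect p q t j : poly_le p q ->
  Derive_n (fun x => - q (2 * t - x)) j t = - (-1) ^ j * Derive_n q j t.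
Proof.
  intros Hq. rewrite Derive_n_opp.
  rewrite (Derive_n_ext _ (fun x => (fun y => q (y + 2 * t)) (- x)));
    [|intros; f_equal; ring].
  rewrite (Derive_n_comp_opp (fun y => q (y + 2 * t))).
  - rewrite Derive_n_comp_trans. replace (- t + 2 * t) with t by ring. ring.
  - apply filter_forall. intros y k _. apply (poly_ex_derive_n p).
    apply poly_le_ext with (fun x => q (1 * x + 2 * t)); [|intros; f_equal; ring].
    now apply poly_le_affine.
Qed.

Lemma poly_le_reflect p q t : poly_le p q -> poly_le p (fun x => - q (2 * t - x)).
Proof.
  intros Hq. apply poly_le_ext with (fun x => -1 * q (-1 * x + 2 * t)).
  - now apply poly_le_scal, poly_le_affine.
  - intros x. replace (-1 * x + 2 * t) with (2 * t - x) by ring. ring.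
Qed.

Lemma pow_opp1_even k : (-1) ^ (2 * k) = 1.
Proof. rewrite pow_mult. replace ((-1) ^ 2) with 1 by ring. apply pow1. Qed.

(** The half-turn about (t, 0) multiplies the derivative of order j at t by -(-1)^j. Odd orders
    match automatically and even orders match because they vanish, so [poly_glue] applies. *)
Lemma reflect_glue p q t : poly_le p q ->
  (forall k, (2 * k < p)%nat -> Derive_n q (2 * k) t = 0) ->
  exists c, forall x, - q (2 * t - x) = q x + c * (x - t) ^ p.
Proof.
  intros Hq H. apply poly_glue; [exact Hq | now apply poly_le_reflect|].
  intros j Hj. rewrite (poly_Derive_n_reflect p) by exact Hq.
  destruct (Nat.Even_or_Odd j) as [[k ->]|[k ->]].
  - rewrite H by exact Hj. ring.
  - rewrite pow_add, pow_opp1_even. ring.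
Qed.

(** Converse of [reflect_glue]: an even derivative of order below [p] at [t] kills the power on the
    right and turns the left side into minus twice that derivative of [q]. *)
Lemma reflect_flat p q t c : poly_le p q ->
  (forall x, - q (2 * t - x) = q x + c * (x - t) ^ p) ->
  forall k, (2 * k < p)%nat -> Derive_n q (2 * k) t = 0.
Proof.
  intros Hq H k Hk.
  assert (E : Derive_n (fun x => (- q (2 * t - x)) - q x) (2 * k) t =
              Derive_n (fun x => c * (x + - t) ^ p) (2 * k) t).
  { apply Derive_n_ext. intros x. rewrite H. unfold Rminus. ring. }
  rewrite (poly_Derive_n_minus p), (poly_Derive_n_reflect p), pow_opp1_even in E;
    [|assumption | now apply poly_le_reflect | assumption].
  rewrite Derive_n_scal_l, (Derive_n_comp_trans (fun x => x ^ p)), Derive_n_pow_smalli in E by lia.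
  rewrite Rplus_opp_r, pow_i in E by lia. lra.
Qed.

(** * Splines on the line *)

(* For piecewise polynomials of degree p, being C^(p-1) at the knot t means that
   the two pieces differ by a multiple c of (x - t)^p. *)
Definition knotc (p : nat) (h : R) (w : R -> R) (t c : R) : Prop :=
  exists q, poly_le p q /\ (forall x, t - h <= x <= t -> w x = q x) /\
    forall x, t <= x <= t + h -> w x = q x + c * (x - t) ^ p.

Lemma knotc_ext p h w w' t c :
  (forall x, w' x = w x) -> knotc p h w t c -> knotc p h w' t c.
Proof.
  intros E [q [Hq [Hl Hr]]]. exists q.
  split; [exact Hq | split; intros x Hx; rewrite E; auto].
Qed.

Lemma knotc_plus p h w w' t c c' :
  knotc p h w t c -> knotc p h w' t c' -> knotc p h (fun x => w x + w' x) t (c + c').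
Proof.
  intros [q [Hq [Hl Hr]]] [q' [Hq' [Hl' Hr']]]. exists (fun x => q x + q' x).
  split; [now apply poly_le_plus | split; intros x Hx].
  - rewrite Hl, Hl'; auto.
  - rewrite Hr, Hr' by auto. ring.
Qed.

Lemma knotc_scal p h a w t c :
  knotc p h w t c -> knotc p h (fun x => a * w x) t (a * c).
Proof.
  intros [q [Hq [Hl Hr]]]. exists (fun x => a * q x).
  split; [now apply poly_le_scal | split; intros x Hx].
  - rewrite Hl; auto.
  - rewrite Hr by auto. ring.
Qed.

Lemma knotc_lin p h m b f t c :
  (forall j, (1 <= j <= m)%nat -> knotc p h (f j) t (c j)) ->
  knotc p h (lin m b f) t (sum1 (fun j => b j * c j) m).
Proof.
  induction m as [|m IH]; intros H.
  - exists (fun _ => 0). split; [apply poly_le_const|].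
    unfold lin. split; intros x _; rewrite !sum1_0; ring.
  - rewrite sum1_S. apply knotc_ext with (fun x => lin m b f x + b (S m) * f (S m) x).
    + intros x. unfold lin. apply sum1_S.
    + apply knotc_plus; [apply IH; intros; apply H; lia|].
      apply knotc_scal, H. lia.
Qed.

Lemma knotc_shift p h w t c a :
  knotc p h w t c -> knotc p h (fun x => w (x + a)) (t - a) c.
Proof.
  intros [q [Hq [Hl Hr]]]. exists (fun x => q (1 * x + a)).
  split; [now apply poly_le_affine|].
  split; intros x Hx; rewrite Rmult_1_l; [apply Hl; lra|].
  replace (x - (t - a)) with (x + a - t) by ring. apply Hr. lra.
Qed.

(** Mirroring exchanges the two pieces, so the former right piece becomes the base polynomial and
    the jump becomes [- c * (-1) ^ p]. *)
Lemma knotc_opp p h w t c :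
  knotc p h w t c -> exists c', knotc p h (fun x => w (- x)) (- t) c'.
Proof.
  intros [q [Hq [Hl Hr]]]. exists (- c * (-1) ^ p).
  exists (fun x => q (-1 * x + 0) + c * (-1 * x + - t) ^ p). split.
  - apply poly_le_plus; [now apply poly_le_affine|].
    apply poly_le_scal, poly_le_pow_affine.
  - split; intros x Hx; replace (-1 * x + 0) with (- x) by ring.
    + replace (-1 * x + - t) with (- x - t) by ring. apply Hr. lra.
    + replace (-1 * x + - t) with (-1 * (x - - t)) by ring.
      rewrite Rpow_mult_distr, Hl by lra. ring.
Qed.

(** * Periodic functions and periodic extension *)

Lemma periodic_Z (w : R -> R) T :
  (forall x, w (x + T) = w x) -> forall (k : Z) x, w (x + T * IZR k) = w x.
Proof.
  intros H k. induction k as [|k IH|k IH] using Z.peano_ind; intros x.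
  - f_equal. ring.
  - unfold Z.succ. rewrite plus_IZR. replace (x + T * (IZR k + 1)) with (x + T * IZR k + T) by ring.
    rewrite H. apply IH.
  - unfold Z.pred. rewrite plus_IZR. rewrite <- H.
    replace (x + T * (IZR k + -1) + T) with (x + T * IZR k) by ring. apply IH.
Qed.

Lemma reduce_mod a T x : 0 < T ->
  a <= x - T * IZR (Int_part ((x - a) / T)) < a + T.
Proof.
  intros HT. destruct (base_Int_part ((x - a) / T)) as [H1 H2].
  set (z := IZR (Int_part ((x - a) / T))) in *.
  assert (E : x - a = T * ((x - a) / T)) by (field; lra).
  set (y := (x - a) / T) in *.
  assert (T * z <= T * y) by (apply Rmult_le_compat_l; lra).
  assert (T * (y - z) < T * 1) by (apply Rmult_lt_compat_l; lra). lra.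
Qed.

(** The T-periodic extension of [f] from [a, a + T). The value of [f] at [a + T] is never read,
    hence the condition [f a = f (a + T)] in [per_eq]. *)
Definition per (T a : R) (f : R -> R) (x : R) : R :=
  f (x - T * IZR (Int_part ((x - a) / T))).

Lemma per_periodic T a f x : 0 < T -> per T a f (x + T) = per T a f x.
Proof.
  intros HT. unfold per.
  replace (Int_part ((x + T - a) / T)) with (Int_part ((x - a) / T) + 1)%Z.
  - rewrite plus_IZR. f_equal. ring.
  - apply Int_part_spec. rewrite plus_IZR.
    replace ((x + T - a) / T) with ((x - a) / T + 1) by (field; lra).
    destruct (base_Int_part ((x - a) / T)). lra.
Qed.

Lemma per_eq T a f x :
  0 < T -> f a = f (a + T) -> a <= x <= a + T -> per T a f x = f x.
Proof.
  intros HT Hf [H1 H2].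
  assert (E : forall y, a <= y < a + T -> per T a f y = f y).
  { intros y Hy. unfold per. rewrite <- (Int_part_spec _ 0); [f_equal; ring|].
    replace ((y - a) / T) with (/ T * (y - a)) by (field; lra).
    assert (0 < / T) by now apply Rinv_0_lt_compat.
    assert (/ T * T = 1) by (field; lra).
    assert (0 <= / T * (y - a)) by (apply Rmult_le_pos; lra).
    assert (/ T * (y - a) < / T * T) by (apply Rmult_lt_compat_l; lra).
    lra. }
  destruct H2 as [H2| ->]; [apply E; lra|].
  rewrite per_periodic, <- Hf by exact HT. apply E. lra.
Qed.

(** * Periodic splines and uniqueness of interpolation *)

Lemma mesh_pos n : (1 <= n)%nat -> 0 < mesh n.
Proof.
  intros Hn. unfold mesh. apply Rdiv_lt_0_compat; [lra|]. apply lt_0_INR. lia.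
Qed.

Lemma mesh_mult n : (1 <= n)%nat -> IZR (Z.of_nat n) * mesh n = 1.
Proof.
  intros Hn. rewrite <- INR_IZR_INZ. unfold mesh. field. apply not_0_INR. lia.
Qed.

(** Since [knotc] describes both cells adjacent to a knot, requiring it at every knot encodes
    piecewise polynomiality and smoothness together. *)
Definition knots (p n : nat) (w : R -> R) : Prop :=
  forall i : Z, exists c, knotc p (mesh n) w (IZR i * mesh n) c.

Lemma knots_intro p n w (a : Z) (N : nat) :
  (1 <= N)%nat ->
  (forall x, w (x + IZR (Z.of_nat N) * mesh n) = w x) ->
  (forall i : Z, (a <= i < a + Z.of_nat N)%Z ->
     exists c, knotc p (mesh n) w (IZR i * mesh n) c) ->
  knots p n w.
Proof.
  intros HN Hp H i.
  pose (k := ((i - a) / Z.of_nat N)%Z).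
  pose proof (Z.div_mod (i - a) (Z.of_nat N) ltac:(lia)) as E. fold k in E.
  pose proof (Z.mod_pos_bound (i - a) (Z.of_nat N) ltac:(lia)).
  destruct (H (i - Z.of_nat N * k)%Z ltac:(lia)) as [c Hc]. exists c.
  apply (knotc_shift _ _ _ _ _ (IZR (Z.of_nat N) * mesh n * IZR (- k))) in Hc.
  replace (IZR i * mesh n) with
    (IZR (i - Z.of_nat N * k) * mesh n - IZR (Z.of_nat N) * mesh n * IZR (- k)).
  - revert Hc. apply knotc_ext. intros x. symmetry. now apply periodic_Z.
  - rewrite minus_IZR, mult_IZR, opp_IZR. ring.
Qed.

(** The 4-periodic model of the periodic splines. On the whole line the space is visibly stable
    under reflection and under translation by multiples of h, with no boundary conditions to
    track. *)
Definition gspline (p n : nat) (w : R -> R) : Prop :=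
  (forall x, w (x + 4) = w x) /\ knots p n w.

Lemma gspline_lin p n m b f :
  (forall j, (1 <= j <= m)%nat -> gspline p n (f j)) -> gspline p n (lin m b f).
Proof.
  intros H. split.
  - intros x. unfold lin. apply sum1_ext. intros j Hj. now rewrite (proj1 (H j Hj)).
  - intros i.
    (* The range of [j] sits inside the existential so that the statement holds for every [j] and
       [functional_choice] applies; 0 is a dummy value outside the range. *)
    assert (E : forall j, exists c, (1 <= j <= m)%nat ->
      knotc p (mesh n) (f j) (IZR i * mesh n) c).
    { intros j. destruct (le_lt_dec 1 j); [destruct (le_lt_dec j m)|].
      - destruct (proj2 (H j ltac:(lia)) i) as [c Hc]. exists c. auto.
      - exists 0. lia.
      - exists 0. lia. }
    apply functional_choice in E. destruct E as [c Hc].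
    exists (sum1 (fun j => b j * c j) m). now apply knotc_lin.
Qed.

Lemma gspline_ext p n w w' :
  (forall x, w' x = w x) -> gspline p n w -> gspline p n w'.
Proof.
  intros E [H1 H2]. split.
  - intros x. now rewrite !E.
  - intros i. destruct (H2 i) as [c Hc]. exists c. now apply (knotc_ext p _ w).
Qed.

Lemma gspline_plus p n w w' :
  gspline p n w -> gspline p n w' -> gspline p n (fun x => w x + w' x).
Proof.
  intros [H1 H2] [H1' H2']. split.
  - intros x. now rewrite H1, H1'.
  - intros i. destruct (H2 i) as [c Hc], (H2' i) as [c' Hc'].
    exists (c + c'). now apply knotc_plus.
Qed.

Lemma gspline_scal p n a w : gspline p n w -> gspline p n (fun x => a * w x).
Proof.
  intros [H1 H2]. split.
  - intros x. now rewrite H1.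
  - intros i. destruct (H2 i) as [c Hc]. exists (a * c). now apply knotc_scal.
Qed.

Lemma gspline_opp p n w : gspline p n w -> gspline p n (fun x => w (- x)).
Proof.
  intros [H1 H2]. split.
  - intros x. rewrite <- H1. f_equal. ring.
  - intros i. destruct (H2 (- i)%Z) as [c Hc].
    apply knotc_opp in Hc. rewrite opp_IZR in Hc.
    replace (- (- IZR i * mesh n)) with (IZR i * mesh n) in Hc by ring. exact Hc.
Qed.

Lemma gspline_shift p n w (k : Z) :
  gspline p n w -> gspline p n (fun x => w (x + IZR k * mesh n)).
Proof.
  intros [H1 H2]. split.
  - intros x. rewrite <- (H1 (x + _)). f_equal. ring.
  - intros i. destruct (H2 (i + k)%Z) as [c Hc]. exists c.
    apply (knotc_shift _ _ _ _ _ (IZR k * mesh n)) in Hc. rewrite plus_IZR in Hc.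
    now replace ((IZR i + IZR k) * mesh n - IZR k * mesh n) with (IZR i * mesh n) in Hc by ring.
Qed.

(** The left side has degree below p when p > 0, so c = 0 and [q] is periodic, hence constant. The
    proof differentiates instead of comparing coefficients: [Derive q] satisfies the same kind of
    relation one degree lower, so it is a constant [e], and the relation at 0 gives [e * T = 0]. *)
Lemma periodic_poly_const p q c T : 0 < T -> poly_le p q ->
  (forall x, q x - q (x + T) = c * x ^ p) -> forall x y, q x = q y.
Proof.
  intros HT. revert q c. induction p as [|p IH]; intros q c Hq H.
  - apply poly_le_0 in Hq. destruct Hq as [a Ha]. intros. now rewrite !Ha.
  - assert (HD : forall x, Derive q x - Derive q (x + T) = c * INR (S p) * x ^ p).
    { intros x.
      assert (Hs : poly_le (S p) (fun x => q (x + T))).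
      { apply poly_le_ext with (fun x => q (1 * x + T));
          [now apply poly_le_affine | intros; now rewrite Rmult_1_l]. }
      assert (E : Derive (fun y => q (y + T)) x = Derive q (x + T))
        by exact (Derive_n_comp_trans q 1 x T).
      rewrite <- E.
      rewrite <- Derive_minus;
        [|now apply (poly_ex_derive (S p)) | now apply (poly_ex_derive (S p))].
      apply is_derive_unique.
      apply is_derive_ext with (fun x => c * (x - 0) ^ S p).
      - intros t. rewrite Rminus_0_r. symmetry. apply H.
      - pose proof (is_derive_pow_shift p 0 x) as D.
        apply (is_derive_scal _ _ c) in D.
        replace (c * INR (S p) * x ^ p) with (c * (INR (S p) * (x - 0) ^ p)); [exact D|].
        rewrite Rminus_0_r. ring. }
    pose proof (IH (Derive q) _ (poly_Derive _ _ Hq) HD) as HC.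
    apply (poly_Derive_zero (S p)); [exact Hq|]. intros x.
    set (e := Derive q 0).
    assert (Hlin : forall x, is_derive (fun x => q x - e * x) x 0).
    { intros y. replace 0 with (e - e) by ring. apply @is_derive_minus.
      - unfold e. rewrite (HC 0 y). apply Derive_correct. now apply (poly_ex_derive (S p)).
      - auto_derive; [trivial | ring]. }
    pose proof (derive_zero_const _ Hlin 0 (0 + T)) as E. simpl in E.
    specialize (H 0). rewrite pow_i in H by lia.
    rewrite (HC x 0). fold e. assert (e * T = 0) by lra.
    destruct (Rmult_integral _ _ H0); lra.
Qed.

(** Without jumps at h, ..., (4n-1)h the spline is one polynomial [q] on [0, 4]. By periodicity the
    piece to the left of 0 is [q (x + 4)], so the only remaining jump reads
    [q x - q (x + 4) = c * x ^ p], which forces [q] to be constant. *)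
Lemma gspline_flat p n w : (1 <= n)%nat -> gspline p n w ->
  (forall i, (1 <= i < 4 * n)%nat -> knotc p (mesh n) w (INR i * mesh n) 0) ->
  w 0 = 0 -> forall x, w x = 0.
Proof.
  intros Hn [Hper Hk] Hflat H0.
  pose proof (mesh_pos n Hn) as Hh. pose proof (mesh_mult n Hn) as Hm.
  destruct (Hk 0%Z) as [c [q0 [Hq0 [Hl Hr]]]].
  rewrite Rmult_0_l in Hl, Hr. set (h := mesh n) in *.
  (* The piece to the right of 0, with the base of the power in the affine shape that
     [poly_le_pow_affine] expects. *)
  pose (q := fun x => q0 x + c * (1 * x + 0) ^ p).
  assert (Hq : poly_le p q).
  { apply poly_le_plus; [exact Hq0 | apply poly_le_scal, poly_le_pow_affine]. }
  assert (Hcell : forall m, (1 <= m <= 4 * n)%nat ->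
    forall x, 0 <= x <= INR m * h -> w x = q x).
  { induction m as [|m IH]; intros Hmn x Hx; [lia|].
    destruct (Nat.eq_dec m 0) as [->|Hm0].
    - simpl in Hx. rewrite Hr by lra. unfold q. now rewrite Rminus_0_r, Rplus_0_r, Rmult_1_l.
    - destruct (Rle_dec x (INR m * h)) as [Hle|Hgt]; [apply IH; [lia | lra]|].
      destruct (Hflat m ltac:(lia)) as [q' [Hq' [Hl' Hr']]].
      rewrite S_INR in Hx. rewrite Hr' by lra.
      assert (1 <= INR m) by (apply (le_INR 1); lia).
      assert (1 * h <= INR m * h) by (apply Rmult_le_compat_r; lra).
      rewrite (poly_eq p q' q (INR m * h - h) (INR m * h)); [ring | auto | auto | lra|].
      intros y Hy. rewrite <- Hl' by lra. apply IH; [lia | lra]. }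
  assert (H4 : INR (4 * n) * h = 4).
  { rewrite mult_INR, (INR_IZR_INZ n), Rmult_assoc, Hm. simpl. ring. }
  (* Needed so that the cell (-h, 0), translated by 4, lies in [0, 4]. *)
  assert (Hh1 : h <= 1).
  { rewrite <- Hm. rewrite <- (Rmult_1_l h) at 1. apply Rmult_le_compat_r; [lra|].
    apply IZR_le. lia. }
  specialize (Hcell (4 * n)%nat ltac:(lia)). rewrite H4 in Hcell.
  assert (Hshift : forall x, q0 x = q (1 * x + 4)).
  { apply (poly_eq p _ _ (- h) 0); [auto | now apply poly_le_affine | lra|].
    intros x Hx. rewrite <- Hl by lra. rewrite <- Hper, Rmult_1_l. apply Hcell. lra. }
  assert (Hconst : forall x y, q x = q y).
  { apply (periodic_poly_const p q c 4); [lra | exact Hq|].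
    intros x. unfold q at 1. rewrite Hshift, !Rmult_1_l, Rplus_0_r. ring. }
  intros x.
  rewrite <- (periodic_Z w 4 Hper (- Int_part ((x - 0) / 4))), opp_IZR.
  pose proof (reduce_mod 0 4 x ltac:(lra)).
  replace (x + 4 * - IZR (Int_part ((x - 0) / 4))) with
    (x - 4 * IZR (Int_part ((x - 0) / 4))) by ring.
  rewrite Hcell by lra. rewrite (Hconst _ 0), <- Hcell by lra. exact H0.
Qed.

(* The linear map sending a spline to its jump coefficients at [4n-1] of the
   [4n] knots and to its value at 0 is injective; hence any [4n + 1] splines
   are dependent and the [4n] Lagrange functions span. *)
Lemma gspline_interp_unique p n (L : Z -> R -> R) s : (1 <= n)%nat ->
  (forall j, node_index n j -> gspline p n (L j) /\
     forall i, node_index n i -> L j (node p n i) = if Z.eqb i j then 1 else 0) ->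
  gspline p n s -> (forall i, node_index n i -> s (node p n i) = 0) ->
  forall x, s x = 0.
Proof.
  intros Hn HL Hs Hs0.
  set (f := fun j : nat =>
    if Nat.eq_dec j (S (4 * n)) then s else L (Z.of_nat j - 2 * Z.of_nat n)%Z).
  assert (Hlast : f (S (4 * n)) = s).
  { unfold f. destruct (Nat.eq_dec (S (4 * n)) (S (4 * n))); [reflexivity | lia]. }
  assert (Hfirst : forall j, (1 <= j <= 4 * n)%nat -> f j = L (Z.of_nat j - 2 * Z.of_nat n)%Z).
  { intros j Hj. unfold f. destruct (Nat.eq_dec j (S (4 * n))); [lia | reflexivity]. }
  assert (Hidx : forall j, (1 <= j <= 4 * n)%nat -> node_index n (Z.of_nat j - 2 * Z.of_nat n)).
  { intros j Hj. unfold node_index. lia. }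
  assert (Hf : forall j, (1 <= j <= S (4 * n))%nat -> gspline p n (f j)).
  { intros j Hj. destruct (Nat.eq_dec j (S (4 * n))) as [->|]; [now rewrite Hlast|].
    rewrite Hfirst by lia. apply HL, Hidx. lia. }
  assert (HC : forall ji : nat * nat, exists c, (1 <= fst ji <= S (4 * n))%nat ->
    knotc p (mesh n) (f (fst ji)) (INR (snd ji) * mesh n) c).
  { intros [j i]. simpl.
    destruct (le_lt_dec 1 j); [destruct (le_lt_dec j (S (4 * n)))|].
    - destruct (proj2 (Hf j ltac:(lia)) (Z.of_nat i)) as [c Hc].
      rewrite <- INR_IZR_INZ in Hc. exists c. auto.
    - exists 0. lia.
    - exists 0. lia. }
  apply functional_choice in HC. destruct HC as [C HC].
  (* Coordinates i < 4n are the jumps at the knots ih; the last coordinate, free because the jump at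
     4nh is left out, holds the value at 0. *)
  destruct (linear_dependence (4 * n)
    (fun j i => if Nat.eq_dec i (4 * n) then f j 0 else C (j, i)))
    as [b [[j0 [Hj0 Hb0]] Hb]].
  assert (HW : forall x, lin (S (4 * n)) b f x = 0).
  { apply (gspline_flat p n); [exact Hn | now apply gspline_lin | |].
    - intros i Hi. specialize (Hb i ltac:(lia)).
      destruct (Nat.eq_dec i (4 * n)); [lia|]. rewrite <- Hb.
      apply knotc_lin. intros j Hj. now apply (HC (j, i)).
    - specialize (Hb (4 * n)%nat ltac:(lia)).
      destruct (Nat.eq_dec (4 * n) (4 * n)); [exact Hb | lia]. }
  (* At a node [s] vanishes and the Lagrange functions are 0 or 1, so the relation isolates one
     coefficient. Only the coefficient of [s] can then be nonzero. *)
  assert (Hz : forall k, (1 <= k <= 4 * n)%nat -> b k = 0).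
  { intros k Hk. pose proof (HW (node p n (Z.of_nat k - 2 * Z.of_nat n))) as E.
    unfold lin in E. rewrite sum1_S, Hlast, Hs0, (sum1_single _ _ k) in E;
      [|exact Hk| |now apply Hidx].
    - rewrite Hfirst, (proj2 (HL _ (Hidx k Hk))), Z.eqb_refl in E by auto. lra.
    - intros j Hj Hne. rewrite Hfirst, (proj2 (HL _ (Hidx j Hj))) by auto.
      destruct (Z.eqb_spec (Z.of_nat k - 2 * Z.of_nat n) (Z.of_nat j - 2 * Z.of_nat n));
        [lia | ring]. }
  intros x. pose proof (HW x) as E. unfold lin in E.
  rewrite sum1_S, Hlast, sum1_zero in E; [|intros j Hj; rewrite Hz by exact Hj; ring].
  assert (b (S (4 * n)) <> 0).
  { destruct (Nat.eq_dec j0 (S (4 * n))) as [<-|]; [exact Hb0|].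
    elim Hb0. apply Hz. lia. }
  destruct (Rmult_integral (b (S (4 * n))) (s x)); [lra | contradiction | assumption].
Qed.

(** * From one-sided derivatives to jump conditions *)

(** The accumulation hypothesis of [single_limit]. It includes the end points, which is what makes
    one-sided derivatives there unique. *)
Lemma adhDa_interval a b x : a < b -> a <= x <= b ->
  adhDa (D_x (fun y => a < y < b) x) x.
Proof.
  intros Hab Hx eps He. unfold D_x, Rdist.
  destruct (Rle_lt_dec b x) as [Hb|Hb].
  - exists (x - Rmin (eps / 2) ((b - a) / 2)).
    assert (0 < Rmin (eps / 2) ((b - a) / 2)) by (apply Rmin_case; lra).
    pose proof (Rmin_l (eps / 2) ((b - a) / 2)).
    pose proof (Rmin_r (eps / 2) ((b - a) / 2)).
    split; [lra|]. apply Rabs_def1; lra.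
  - exists (x + Rmin (eps / 2) ((b - x) / 2)).
    assert (0 < Rmin (eps / 2) ((b - x) / 2)) by (apply Rmin_case; lra).
    pose proof (Rmin_l (eps / 2) ((b - x) / 2)).
    pose proof (Rmin_r (eps / 2) ((b - x) / 2)).
    split; [lra|]. apply Rabs_def1; lra.
Qed.

Lemma D_in_mono (D D' : R -> Prop) f d x :
  (forall y, D' y -> D y) -> D_in f d D x -> D_in f d D' x.
Proof.
  intros H. apply limit1_imp. intros y [H1 H2]. split; auto.
Qed.

Lemma continue_in_mono (D D' : R -> Prop) f x :
  (forall y, D' y -> D y) -> continue_in f D x -> continue_in f D' x.
Proof.
  intros H. apply limit1_imp. intros y [H1 H2]. split; auto.
Qed.

Lemma derivs_on_mono a b a' b' k v d :
  a <= a' -> b' <= b -> derivs_on a b k v d -> derivs_on a' b' k v d.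
Proof.
  intros Ha Hb [H0 [HD HC]]. unfold seg in *.
  assert (Hs : forall y, a' <= y <= b' -> a <= y <= b) by (intros; lra).
  split; [auto | split].
  - intros j x Hj Hx. apply (D_in_mono (seg a b)); [exact Hs|]. auto.
  - intros x Hx. apply (continue_in_mono (seg a b)); [exact Hs|]. auto.
Qed.

Lemma derivs_on_continue a b k v d j x :
  derivs_on a b k v d -> (j <= k)%nat -> seg a b x -> continue_in (d j) (seg a b) x.
Proof.
  intros [_ [HD HC]] Hj Hx. destruct (Nat.eq_dec j k) as [->|]; [auto|].
  apply cont_deriv with (d (S j)). apply HD; [lia | exact Hx].
Qed.

Lemma poly_D_in p q j D x :
  poly_le p q -> D_in (Derive_n q j) (Derive_n q (S j)) D x.
Proof.
  intros Hq. apply (D_in_mono no_cond); [intros; exact I|].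
  apply derivable_pt_lim_D_in. apply is_derive_Reals. simpl. apply Derive_correct.
  apply (poly_ex_derive (p - j)). now apply poly_Derive_n.
Qed.

(** Uniqueness of limits taken inside the open cell identifies the derivatives up to and including
    its end points. Two neighbouring pieces therefore share their derivatives at the common knot, as
    [poly_glue] requires. *)
Lemma derivs_on_poly p a b k v d q a' b' :
  derivs_on a b k v d -> poly_le p q -> a <= a' -> b' <= b -> a' < b' ->
  (forall x, a' < x < b' -> v x = q x) ->
  forall j x, (j <= k)%nat -> a' <= x <= b' -> d j x = Derive_n q j x.
Proof.
  intros Hd Hq Ha Hb Hab Hv.
  pose (D := fun y => a' < y < b').
  assert (HDseg : forall y, D y -> seg a b y) by (unfold D, seg; intros; lra).
  induction j as [|j IH]; intros x Hj Hx.
  (* [v] is known to equal [q] only on the open cell; continuity carries the equality to the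
     ends. *)
  - apply (single_limit (d 0%nat) (D_x D x) _ _ x); [now apply adhDa_interval| |].
    + apply (continue_in_mono (seg a b)); [exact HDseg|].
      apply (derivs_on_continue a b k v); [exact Hd | exact Hj | unfold seg; lra].
    + apply limit1_ext with q.
      * intros y [Hy _]. rewrite (proj1 Hd) by auto. symmetry. now apply Hv.
      * apply (cont_deriv q (Derive_n q 1)). now apply (poly_D_in p q 0).
  - apply (single_limit (fun y => (d j y - d j x) / (y - x)) (D_x D x) _ _ x);
      [now apply adhDa_interval| |].
    + apply (D_in_mono (seg a b)); [exact HDseg|].
      apply Hd; [lia | unfold seg; lra].
    + apply limit1_ext with (fun y => (Derive_n q j y - Derive_n q j x) / (y - x)).
      * intros y [Hy _]. unfold D in Hy. rewrite !IH; [reflexivity | lia | lra | lia | lra].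
      * now apply (poly_D_in p).
Qed.

Lemma Ck_on_plus a b k v w : Ck_on a b k v -> Ck_on a b k w ->
  Ck_on a b k (fun x => v x + w x).
Proof.
  intros [d [H0 [HD HC]]] [d' [H0' [HD' HC']]].
  exists (fun j x => d j x + d' j x). split; [|split].
  - intros x Hx. now rewrite H0, H0'.
  - intros j x Hj Hx. apply Dadd; auto.
  - intros x Hx. unfold continue_in. apply limit_plus; [now apply HC | now apply HC'].
Qed.

Lemma Ck_on_scal a b k e v : Ck_on a b k v -> Ck_on a b k (fun x => e * v x).
Proof.
  intros [d [H0 [HD HC]]]. exists (fun j x => e * d j x). split; [|split].
  - intros x Hx. now rewrite H0.
  - intros j x Hj Hx. apply Dmult_const; auto.
  - intros x Hx. unfold continue_in. apply limit_mul; [|now apply HC].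
    now apply (limit_free (fun _ => e)).
Qed.

Lemma Ck_on_ext a b k v w :
  (forall x, seg a b x -> w x = v x) -> Ck_on a b k v -> Ck_on a b k w.
Proof.
  intros E [d [H0 H]]. exists d. split; [|exact H].
  intros x Hx. rewrite E by exact Hx. auto.
Qed.

Lemma Ck_on_zero a b k : Ck_on a b k (fun _ => 0).
Proof.
  exists (fun _ _ => 0). split; [auto | split].
  - intros j x _ _. apply (D_in_mono no_cond); [intros; exact I|]. apply Dconst.
  - intros x _. unfold continue_in. now apply (limit_free (fun _ => 0)).
Qed.

Lemma Ck_on_lin a b k m e f :
  (forall j, (1 <= j <= m)%nat -> Ck_on a b k (f j)) -> Ck_on a b k (lin m e f).
Proof.
  induction m as [|m IH]; intros H.
  - apply Ck_on_ext with (fun _ => 0); [intros; apply sum1_0 | apply Ck_on_zero].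
  - apply Ck_on_ext with (fun x => lin m e f x + e (S m) * f (S m) x).
    + intros x _. unfold lin. apply sum1_S.
    + apply Ck_on_plus; [apply IH; intros; apply H; lia | apply Ck_on_scal, H; lia].
Qed.

Lemma IZR_mesh_le n i j : (1 <= n)%nat -> (i <= j)%Z -> IZR i * mesh n <= IZR j * mesh n.
Proof.
  intros Hn Hij. apply Rmult_le_compat_r; [left; now apply mesh_pos | now apply IZR_le].
Qed.

Lemma IZR_mesh_S n i : IZR (i + 1) * mesh n = IZR i * mesh n + mesh n.
Proof. rewrite plus_IZR. ring. Qed.

Lemma spline_per_endpoints p n v : spline_per p n v -> v (-2) = v 2.
Proof.
  intros [[d [[H0 _] He]] _].
  rewrite <- !H0 by (unfold seg; lra). apply He. lia.
Qed.

(** One period of knots suffices. At interior knots the two pieces share the derivatives [d j]; the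
    knot -2 is the seam of the extension, where the periodic boundary conditions take over. *)
Lemma spline_per_gspline p n v : (1 <= p)%nat -> (1 <= n)%nat ->
  spline_per p n v -> gspline p n (per 4 (-2) v).
Proof.
  intros Hp Hn Hv.
  pose proof (spline_per_endpoints p n v Hv) as Hends.
  destruct Hv as [[d [Hd He]] Hpoly].
  pose proof (mesh_pos n Hn) as Hh. pose proof (mesh_mult n Hn) as Hm.
  assert (Hm2 : IZR (2 * Z.of_nat n) * mesh n = 2) by (rewrite mult_IZR; lra).
  assert (Hm2' : IZR (- 2 * Z.of_nat n) * mesh n = -2) by (rewrite mult_IZR; lra).
  set (h := mesh n) in *.
  assert (HS : forall i, IZR (i + 1) * h = IZR i * h + h) by (intros; apply IZR_mesh_S).
  assert (Hper : forall x, per 4 (-2) v (x + 4) = per 4 (-2) v x)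
    by (intros; apply per_periodic; lra).
  assert (Hin : forall x, -2 <= x <= 2 -> per 4 (-2) v x = v x).
  { intros x Hx. apply per_eq; [lra | now replace (-2 + 4) with 2 by ring | lra]. }
  assert (Hcell : forall i, (- 2 * Z.of_nat n <= i <= 2 * Z.of_nat n - 1)%Z ->
    -2 <= IZR i * h /\ IZR (i + 1) * h <= 2 /\
    exists q, poly_le p q /\
      forall j x, (j <= p - 1)%nat -> IZR i * h <= x <= IZR (i + 1) * h ->
        d j x = Derive_n q j x).
  { intros i Hi.
    assert (H1 : -2 <= IZR i * h) by (rewrite <- Hm2'; apply IZR_mesh_le; lia).
    assert (H2 : IZR (i + 1) * h <= 2) by (rewrite <- Hm2; apply IZR_mesh_le; lia).
    split; [exact H1 | split; [exact H2|]].
    destruct (Hpoly i Hi) as [q [Hq Hvq]]. exists q. split; [exact Hq|].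
    apply (derivs_on_poly p (-2) 2 (p - 1) v); try assumption.
    rewrite HS; lra. }
  assert (Hvd : forall x, -2 <= x <= 2 -> per 4 (-2) v x = d 0%nat x).
  { intros x Hx. rewrite Hin by exact Hx. symmetry. now apply (proj1 Hd). }
  split; [exact Hper|].
  apply (knots_intro p n _ (- 2 * Z.of_nat n) (4 * n)); [lia | |].
  - intros x. fold h. rewrite Nat2Z.inj_mul, mult_IZR, Rmult_assoc, Hm, <- (Hper x).
    f_equal. simpl. ring.
  - intros i Hi. fold h.
    destruct (Hcell i ltac:(lia)) as [H1 [H2 [q2 [Hq2 E2]]]].
    rewrite HS in H2, E2.
    destruct (Z.eq_dec i (- 2 * Z.of_nat n)) as [->|Hne].
    (* The piece to the left of -2 is that of the last cell, ending at 2, translated by 4. *)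
    + rewrite Hm2' in *.
      destruct (Hcell (2 * Z.of_nat n - 1)%Z ltac:(lia)) as [H1' [H2' [q1 [Hq1 E1]]]].
      pose proof (HS (2 * Z.of_nat n - 1)%Z) as Es'.
      replace (2 * Z.of_nat n - 1 + 1)%Z with (2 * Z.of_nat n)%Z in * by ring.
      rewrite Hm2 in *.
      assert (Hq1' : poly_le p (fun x => q1 (x + 4))).
      { apply poly_le_ext with (fun x => q1 (1 * x + 4));
          [now apply poly_le_affine | intros; now rewrite Rmult_1_l]. }
      destruct (poly_glue p (fun x => q1 (x + 4)) q2 (-2)) as [c Hc]; try assumption.
      { intros j Hj. rewrite Derive_n_comp_trans. replace (-2 + 4) with 2 by ring.
        rewrite <- E1, <- E2 by (lia || lra). symmetry. apply He. lia. }
      exists c, (fun x => q1 (x + 4)). split; [exact Hq1' | split; intros x Hx].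
      * rewrite <- Hper, Hvd by lra. apply (E1 0%nat); [lia | lra].
      * rewrite Hvd by lra. rewrite <- Hc. apply (E2 0%nat); [lia | lra].
    + destruct (Hcell (i - 1)%Z ltac:(lia)) as [H1' [H2' [q1 [Hq1 E1]]]].
      pose proof (HS (i - 1)%Z) as Es'.
      replace (i - 1 + 1)%Z with i in * by ring.
      destruct (poly_glue p q1 q2 (IZR i * h)) as [c Hc]; try assumption.
      { intros j Hj. rewrite <- E1, <- E2 by (lia || lra). reflexivity. }
      exists c, q1. split; [exact Hq1 | split; intros x Hx].
      * rewrite Hvd by lra. apply (E1 0%nat); [lia | lra].
      * rewrite Hvd by lra. rewrite <- Hc. apply (E2 0%nat); [lia | lra].
Qed.

(** * Odd 2-periodic extension of reduced splines *)

Definition odd_ext (v : R -> R) : R -> R :=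
  per 2 (-1) (fun x => if Rle_dec 0 x then v x else - v (- x)).

Lemma odd_ext_periodic v x : odd_ext v (x + 2) = odd_ext v x.
Proof. apply per_periodic. lra. Qed.

Lemma odd_ext_eq v x : v 1 = 0 -> -1 <= x <= 1 ->
  odd_ext v x = if Rle_dec 0 x then v x else - v (- x).
Proof.
  intros v1 Hx. apply per_eq; [lra | | lra].
  destruct (Rle_dec 0 (-1)); [lra|]. destruct (Rle_dec 0 (-1 + 2)); [|lra].
  replace (-1 + 2) with 1 by ring. replace (- (-1)) with 1 by ring. rewrite v1. ring.
Qed.

Lemma odd_ext_pos v x : v 1 = 0 -> 0 <= x <= 1 -> odd_ext v x = v x.
Proof.
  intros v1 Hx. rewrite odd_ext_eq by (exact v1 || lra). destruct (Rle_dec 0 x); [reflexivity | lra].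
Qed.

Lemma odd_ext_odd v x : v 0 = 0 -> v 1 = 0 -> odd_ext v (- x) = - odd_ext v x.
Proof.
  intros v0 v1. pose (k := Int_part ((x - -1) / 2)).
  pose proof (reduce_mod (-1) 2 x ltac:(lra)) as Hr. fold k in Hr.
  pose proof (periodic_Z _ 2 (odd_ext_periodic v)) as HZ.
  rewrite <- (HZ (- k)%Z x), <- (HZ k (- x)), opp_IZR.
  replace (- x + 2 * IZR k) with (- (x + 2 * - IZR k)) by ring.
  replace (x - 2 * IZR k) with (x + 2 * - IZR k) in Hr by ring.
  set (y := x + 2 * - IZR k) in *.
  rewrite !odd_ext_eq by (exact v1 || lra).
  destruct (Rle_dec 0 (- y)), (Rle_dec 0 y); try lra.
  - replace y with 0 by lra. rewrite Ropp_0, v0. ring.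
  - rewrite Ropp_involutive. reflexivity.
Qed.

(** Smoothness of [v] glues the knots inside (0, 1). At 0 and 1 a piece meets its own half-turn, so
    [reflect_glue] needs the even derivatives of order below p to vanish: order 0 comes from the
    boundary values, the others from the reduced space. Negative knots follow by oddness. *)
Lemma spline_reg_gspline p n v : (1 <= p)%nat -> (1 <= n)%nat ->
  spline_reg p n v -> gspline p n (odd_ext v).
Proof.
  intros Hp Hn [[_ [Hpoly [v0 v1]]] [d [Hd Hev]]].
  pose proof (mesh_pos n Hn) as Hh. pose proof (mesh_mult n Hn) as Hm.
  set (h := mesh n) in *.
  assert (HS : forall i, IZR (i + 1) * h = IZR i * h + h) by (intros; apply IZR_mesh_S).
  pose proof (fun x => odd_ext_odd v x v0 v1) as Hodd.
  pose proof (odd_ext_periodic v) as Hper.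
  pose proof (fun x => odd_ext_pos v x v1) as Hpos.
  assert (Hd0 : forall x, 0 <= x <= 1 -> v x = d 0%nat x)
    by (intros x Hx; symmetry; now apply (proj1 Hd)).
  assert (Heven : forall t, t = 0 \/ t = 1 -> forall k, (2 * k < p)%nat -> d (2 * k)%nat t = 0).
  { intros t Ht k Hk. destruct k as [|k].
    - simpl. rewrite <- Hd0 by (destruct Ht; lra). destruct Ht as [-> | ->]; assumption.
    - destruct (Hev (S k)) as [H0 H1].
      { split; [lia|]. apply Nat.div_le_lower_bound; lia. }
      destruct Ht as [-> | ->]; assumption. }
  assert (Hcell : forall i, (0 <= i < Z.of_nat n)%Z ->
    0 <= IZR i * h /\ IZR (i + 1) * h <= 1 /\
    exists q, poly_le p q /\
      forall j x, (j <= p - 1)%nat -> IZR i * h <= x <= IZR (i + 1) * h ->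
        d j x = Derive_n q j x).
  { intros i Hi.
    assert (H1 : 0 <= IZR i * h).
    { replace 0 with (IZR 0 * h) by ring. apply IZR_mesh_le; lia. }
    assert (H2 : IZR (i + 1) * h <= 1) by (rewrite <- Hm; apply IZR_mesh_le; lia).
    split; [exact H1 | split; [exact H2|]].
    destruct (Hpoly (Z.to_nat (i + 1)) ltac:(lia)) as [q [Hq Hvq]].
    exists q. split; [exact Hq|].
    apply (derivs_on_poly p 0 1 (p - 1) v); try assumption.
    - rewrite HS; lra.
    - intros x Hx. apply Hvq. unfold seg. rewrite !INR_IZR_INZ.
      replace (Z.of_nat (Z.to_nat (i + 1) - 1)) with i by lia.
      replace (Z.of_nat (Z.to_nat (i + 1))) with (i + 1)%Z by lia. fold h. lra. }
  assert (Hk : forall i, (0 <= i <= Z.of_nat n)%Z ->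
    exists c, knotc p h (odd_ext v) (IZR i * h) c).
  { intros i Hi. destruct (Z.eq_dec i 0) as [->|H0].
    - destruct (Hcell 0%Z ltac:(lia)) as [_ [H2 [q [Hq E]]]].
      rewrite HS, Rmult_0_l in E, H2.
      rewrite Rmult_0_l. rewrite Rplus_0_l in *.
      destruct (reflect_glue p q 0 Hq) as [c Hc].
      { intros k Hk. rewrite <- E by (lia || lra). apply Heven; auto. }
      (* At 0 the reflected polynomial is the left piece, so the jump of [reflect_glue] changes
         sign; at 1 it is the right piece and the sign stays. *)
      exists (- c), (fun x => - q (2 * 0 - x)).
      split; [now apply poly_le_reflect | split; intros x Hx].
      + replace (2 * 0 - x) with (- x) by ring.
        rewrite <- (Ropp_involutive x) at 1.
        rewrite Hodd, Hpos, Hd0 by lra. f_equal. apply (E 0%nat); [lia | lra].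
      + rewrite Hc, Hpos, Hd0 by lra. rewrite (E 0%nat) by (lia || lra). simpl. ring.
    - destruct (Hcell (i - 1)%Z ltac:(lia)) as [H1 [H2 [q1 [Hq1 E1]]]].
      pose proof (HS (i - 1)%Z) as Es.
      replace (i - 1 + 1)%Z with i in * by ring.
      destruct (Z.eq_dec i (Z.of_nat n)) as [->|Hne].
      + rewrite Hm in *.
        destruct (reflect_glue p q1 1 Hq1) as [c Hc].
        { intros k Hk. rewrite <- E1 by (lia || lra). apply Heven; auto. }
        exists c, q1. split; [exact Hq1 | split; intros x Hx].
        * rewrite Hpos, Hd0 by lra. apply (E1 0%nat); [lia | lra].
        * rewrite <- Hc. replace x with (- (2 * 1 - x) + 2) at 1 by ring.
          rewrite Hper, Hodd, Hpos, Hd0 by lra. f_equal. apply (E1 0%nat); [lia | lra].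
      + destruct (Hcell i ltac:(lia)) as [H1' [H2' [q2 [Hq2 E2]]]].
        rewrite HS in E2, H2'.
        destruct (poly_glue p q1 q2 (IZR i * h)) as [c Hc]; try assumption.
        { intros j Hj. rewrite <- E1, <- E2 by (lia || lra). reflexivity. }
        exists c, q1. split; [exact Hq1 | split; intros x Hx].
        * rewrite Hpos, Hd0 by lra. apply (E1 0%nat); [lia | lra].
        * rewrite Hpos, Hd0 by lra. rewrite <- Hc. apply (E2 0%nat); [lia | lra]. }
  split.
  - intros x. rewrite <- (Hper x), <- (Hper (x + 2)). f_equal. ring.
  - apply (knots_intro p n _ (- Z.of_nat n) (2 * n)); [lia | |].
    + intros x. fold h. rewrite Nat2Z.inj_mul, mult_IZR, Rmult_assoc, Hm, <- (Hper x).
      f_equal. simpl. ring.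
    + intros i Hi. fold h. destruct (Z_le_gt_dec 0 i) as [Hi0|Hi0]; [apply Hk; lia|].
      destruct (Hk (- i)%Z ltac:(lia)) as [c Hc].
      apply knotc_opp in Hc. destruct Hc as [c' Hc]. exists (-1 * c').
      rewrite opp_IZR in Hc.
      replace (- (- IZR i * h)) with (IZR i * h) in Hc by ring.
      apply (knotc_ext p h (fun x => -1 * odd_ext v (- x))).
      * intros x. rewrite Hodd. ring.
      * now apply knotc_scal.
Qed.

(** * Periodic extension of the discrete Fourier functions *)

(** Treats both parities at once: node i is (i - offset/2) h, so reflection sends index i to offset
    - i, and translation by h sends i to i + 1. *)
Definition node_offset (p : nat) : Z := if Nat.odd p then 0%Z else 1%Z.

Lemma node_eq p n i :
  node p n i = (IZR i - IZR (node_offset p) / 2) * mesh n.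
Proof. unfold node, node_offset. destruct (Nat.odd p); simpl; lra. Qed.

Lemma node_opp p n i : - node p n i = node p n (node_offset p - i).
Proof. rewrite !node_eq, minus_IZR. lra. Qed.

Lemma node_shift p n i k : node p n i + IZR k * mesh n = node p n (i + k).
Proof. rewrite !node_eq, plus_IZR. lra. Qed.

Lemma node_period p n (m : Z) i k : (1 <= n)%nat ->
  node p n i + IZR m * IZR k = node p n (i + m * Z.of_nat n * k).
Proof.
  intros Hn. rewrite !node_eq, plus_IZR, !mult_IZR.
  pose proof (mesh_mult n Hn) as Hm.
  replace ((IZR i + IZR m * IZR (Z.of_nat n) * IZR k - IZR (node_offset p) / 2) * mesh n)
    with ((IZR i - IZR (node_offset p) / 2) * mesh n
          + IZR m * IZR k * (IZR (Z.of_nat n) * mesh n)) by ring.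
  rewrite Hm. ring.
Qed.

Lemma node_offset_cases p : node_offset p = 0%Z \/ node_offset p = 1%Z.
Proof. unfold node_offset. destruct (Nat.odd p); auto. Qed.

Lemma node_range p n i : (1 <= n)%nat -> node_index n i -> -2 <= node p n i <= 2.
Proof.
  intros Hn [H1 H2]. pose proof (mesh_pos n Hn) as Hh. pose proof (mesh_mult n Hn) as Hm.
  pose proof (IZR_mesh_le n _ _ Hn H1) as I1. pose proof (IZR_mesh_le n _ _ Hn H2) as I2.
  rewrite plus_IZR, mult_IZR in I1. rewrite mult_IZR in I2.
  rewrite node_eq. destruct (node_offset_cases p) as [-> | ->]; lra.
Qed.

Lemma lagrange_gspline p n L : (1 <= p)%nat -> (1 <= n)%nat -> lagrange_basis p n L ->
  forall j, node_index n j -> gspline p n (per 4 (-2) (L j)) /\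
    forall i, node_index n i -> per 4 (-2) (L j) (node p n i) = if Z.eqb i j then 1 else 0.
Proof.
  intros Hp Hn HL j Hj. destruct (HL j Hj) as [Hs Hd]. split.
  - now apply spline_per_gspline.
  - intros i Hi. rewrite <- Hd by exact Hi.
    pose proof (spline_per_endpoints p n _ Hs). pose proof (node_range p n i Hn Hi).
    apply per_eq; [lra | now replace (-2 + 4) with 2 by ring | lra].
Qed.

Lemma gspline_eq p n L u w : (1 <= p)%nat -> (1 <= n)%nat -> lagrange_basis p n L ->
  gspline p n u -> gspline p n w -> (forall i, u (node p n i) = w (node p n i)) ->
  forall x, u x = w x.
Proof.
  intros Hp Hn HL Hu Hw H x.
  enough (u x + -1 * w x = 0) by lra.
  apply (gspline_interp_unique p n (fun j => per 4 (-2) (L j)) (fun x => u x + -1 * w x) Hn).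
  - now apply lagrange_gspline.
  - apply gspline_plus; [exact Hu | now apply gspline_scal].
  - intros i _. rewrite H. ring.
Qed.

Definition fourier_per (p n : nat) (L : Z -> R -> R) (j : nat) : R -> R :=
  per 4 (-2) (fourier p n L j).

(** Holds by computation: [per] changes only the argument, so it commutes with linear
    combinations. *)
Lemma fourier_per_lin p n L j x : fourier_per p n L j x =
  lin (4 * n) (fun m => sin (node p n (Z.of_nat m - 2 * Z.of_nat n) * (INR j * PI)))
    (fun m => per 4 (-2) (L (Z.of_nat m - 2 * Z.of_nat n)%Z)) x.
Proof. reflexivity. Qed.

Lemma fourier_per_eq p n L j x : lagrange_basis p n L ->
  -2 <= x <= 2 -> fourier_per p n L j x = fourier p n L j x.
Proof.
  intros HL Hx. rewrite fourier_per_lin. apply sum1_ext. intros m Hm.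
  destruct (HL (Z.of_nat m - 2 * Z.of_nat n)%Z) as [Hs _]; [unfold node_index; lia|].
  pose proof (spline_per_endpoints p n _ Hs). cbv zeta. f_equal.
  apply per_eq; [lra | now replace (-2 + 4) with 2 by ring | lra].
Qed.

Lemma fourier_per_gspline p n L j : (1 <= p)%nat -> (1 <= n)%nat ->
  lagrange_basis p n L -> gspline p n (fourier_per p n L j).
Proof.
  intros Hp Hn HL. eapply gspline_ext; [intros; apply fourier_per_lin|].
  apply gspline_lin. intros m Hm. apply lagrange_gspline; auto. unfold node_index. lia.
Qed.

Lemma sin_periodic2 j x : sin ((x + 2) * (INR j * PI)) = sin (x * (INR j * PI)).
Proof.
  replace ((x + 2) * (INR j * PI)) with (x * (INR j * PI) + 2 * INR j * PI) by ring.
  apply sin_period.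
Qed.

Lemma fourier_per_node p n L j i : (1 <= p)%nat -> (1 <= n)%nat ->
  lagrange_basis p n L ->
  fourier_per p n L j (node p n i) = sin (node p n i * (INR j * PI)).
Proof.
  intros Hp Hn HL.
  pose proof (lagrange_gspline p n L Hp Hn HL) as HG.
  assert (Hmain : forall i, node_index n i ->
    fourier_per p n L j (node p n i) = sin (node p n i * (INR j * PI))).
  { intros k Hk. rewrite fourier_per_lin. unfold lin.
    pose proof Hk as [Hk1 Hk2].
    assert (Ek : (Z.of_nat (Z.to_nat (k + 2 * Z.of_nat n)) - 2 * Z.of_nat n)%Z = k) by lia.
    rewrite (sum1_single _ _ (Z.to_nat (k + 2 * Z.of_nat n))); [|lia|].
    - rewrite Ek, (proj2 (HG k Hk)), Z.eqb_refl by exact Hk. ring.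
    - intros m Hm Hne.
      rewrite (proj2 (HG (Z.of_nat m - 2 * Z.of_nat n)%Z ltac:(unfold node_index; lia)))
        by exact Hk.
      destruct (Z.eqb_spec k (Z.of_nat m - 2 * Z.of_nat n)); [lia | ring]. }
  (* The offset puts the remainder modulo 4n into the index range -2n+1, ..., 2n, where the Lagrange
     conditions are available. *)
  pose (a := (i + 2 * Z.of_nat n - 1)%Z).
  pose (k := (a / (4 * Z.of_nat n))%Z).
  pose proof (Z.div_mod a (4 * Z.of_nat n) ltac:(lia)) as E. fold k in E.
  pose proof (Z.mod_pos_bound a (4 * Z.of_nat n) ltac:(lia)).
  specialize (Hmain (i + 4 * Z.of_nat n * - k)%Z ltac:(unfold node_index, a in *; lia)).
  rewrite <- (node_period p n 4) in Hmain by exact Hn.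
  rewrite (periodic_Z _ 4) in Hmain by apply (fourier_per_gspline p n L j Hp Hn HL).
  rewrite Hmain.
  apply (periodic_Z (fun x => sin (x * (INR j * PI)))).
  intros x. replace (x + 4) with (x + 2 + 2) by ring. now rewrite !sin_periodic2.
Qed.

Lemma fourier_per_odd p n L j x : (1 <= p)%nat -> (1 <= n)%nat ->
  lagrange_basis p n L -> fourier_per p n L j (- x) = - fourier_per p n L j x.
Proof.
  intros Hp Hn HL.
  pose proof (fourier_per_gspline p n L j Hp Hn HL) as HG.
  replace (- fourier_per p n L j x) with (-1 * fourier_per p n L j x) by ring.
  apply (gspline_eq p n L (fun x => fourier_per p n L j (- x))
    (fun x => -1 * fourier_per p n L j x) Hp Hn HL).
  - now apply gspline_opp.
  - now apply gspline_scal.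
  - intros i. rewrite node_opp, !fourier_per_node, <- node_opp by auto.
    rewrite Ropp_mult_distr_l_reverse, sin_neg. ring.
Qed.

Lemma fourier_per_periodic2 p n L j x : (1 <= p)%nat -> (1 <= n)%nat ->
  lagrange_basis p n L -> fourier_per p n L j (x + 2) = fourier_per p n L j x.
Proof.
  intros Hp Hn HL.
  pose proof (fourier_per_gspline p n L j Hp Hn HL) as HG.
  replace 2 with (IZR (2 * Z.of_nat n) * mesh n)
    by (rewrite mult_IZR, Rmult_assoc, mesh_mult by exact Hn; ring).
  apply (gspline_eq p n L (fun x => fourier_per p n L j (x + IZR (2 * Z.of_nat n) * mesh n))
    (fourier_per p n L j) Hp Hn HL); [now apply gspline_shift | exact HG|].
  intros i. rewrite node_shift, !fourier_per_node, <- node_shift by auto.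
  rewrite mult_IZR, Rmult_assoc, mesh_mult, Rmult_1_r by exact Hn. apply sin_periodic2.
Qed.

(** At the nodes, which translation by h permutes, this is the addition formula for the sine. *)
Lemma fourier_per_shift p n L j x : (1 <= p)%nat -> (1 <= n)%nat ->
  lagrange_basis p n L ->
  fourier_per p n L j (x + IZR 1 * mesh n) + fourier_per p n L j (x + IZR (-1) * mesh n) =
  2 * cos (mesh n * (INR j * PI)) * fourier_per p n L j x.
Proof.
  intros Hp Hn HL.
  pose proof (fourier_per_gspline p n L j Hp Hn HL) as HG.
  apply (gspline_eq p n L
    (fun x => fourier_per p n L j (x + IZR 1 * mesh n) +
              fourier_per p n L j (x + IZR (-1) * mesh n))
    (fun x => 2 * cos (mesh n * (INR j * PI)) * fourier_per p n L j x) Hp Hn HL).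
  - apply gspline_plus; now apply gspline_shift.
  - now apply gspline_scal.
  - intros i. rewrite !node_shift, !fourier_per_node, <- !node_shift by auto.
    set (y := node p n i). set (a := INR j * PI).
    replace ((y + 1 * mesh n) * a) with (y * a + mesh n * a) by ring.
    replace ((y + -1 * mesh n) * a) with (y * a - mesh n * a) by ring.
    rewrite sin_plus, sin_minus. ring.
Qed.

Lemma nreg_le p n : (nreg p n <= n)%nat.
Proof. unfold nreg. destruct (Nat.odd p); lia. Qed.

(** A period holds 2n nodes, and reflection acts on their indices by i -> offset - i modulo 2n. For
    odd p the indices 0 and n are fixed, so oddness forces the value 0 there and n - 1 pairs remain;
    for even p nothing is fixed and there are n pairs. This is the count [nreg]. *)
Lemma odd_periodic_nodes p n w : (1 <= n)%nat ->
  (forall x, w (- x) = - w x) -> (forall x, w (x + 2) = w x) ->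
  (forall i, (1 <= i <= nreg p n)%nat -> w (node p n (Z.of_nat i)) = 0) ->
  forall i, w (node p n i) = 0.
Proof.
  intros Hn Hodd Hper H.
  assert (HP : forall i k, w (node p n (i + 2 * Z.of_nat n * k)) = w (node p n i)).
  { intros i k. rewrite <- (node_period p n 2) by exact Hn. now apply periodic_Z. }
  assert (HN : forall i, w (node p n (node_offset p - i)) = - w (node p n i)).
  { intros i. now rewrite <- node_opp. }
  assert (H1 : forall i, (1 <= i <= Z.of_nat (nreg p n))%Z -> w (node p n i) = 0).
  { intros i Hi. specialize (H (Z.to_nat i) ltac:(lia)). now rewrite Z2Nat.id in H by lia. }
  intros i.
  pose (N := (2 * Z.of_nat n)%Z).
  pose proof (Z.div_mod i N ltac:(unfold N; lia)) as E.
  pose proof (Z.mod_pos_bound i N ltac:(unfold N; lia)) as Hr.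
  rewrite E, Z.add_comm. unfold N at 2. rewrite HP.
  set (r := (i mod N)%Z) in *. clearbody r.
  (* Residues in the upper half of the period are reflected and then moved by one period into 1,
     ..., nreg. *)
  assert (H2 : forall r, (1 <= node_offset p - r + N <= Z.of_nat (nreg p n))%Z ->
    w (node p n r) = 0).
  { intros s Hs. rewrite <- (Z.opp_involutive s).
    replace (- - s)%Z with (node_offset p - (node_offset p - s))%Z by ring.
    rewrite HN, <- (HP _ 1%Z), H1; [ring | unfold N in Hs; lia]. }
  unfold node_offset, nreg in *. destruct (Nat.odd p).
  - destruct (Z.eq_dec r 0) as [->|].
    { specialize (HN 0%Z). simpl in HN. lra. }
    destruct (Z.eq_dec r (Z.of_nat n)) as [->|].
    { specialize (HN (Z.of_nat n)). rewrite <- (HP _ 1%Z) in HN.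
      replace (0 - Z.of_nat n + 2 * Z.of_nat n * 1)%Z with (Z.of_nat n) in HN by ring. lra. }
    destruct (Z_lt_ge_dec r (Z.of_nat n)); [apply H1; lia | apply H2; lia].
  - destruct (Z.eq_dec r 0) as [->|].
    (* For even p the residue 0 is the node -h/2, the mirror image of node 1. *)
    { specialize (HN 1%Z). simpl in HN. rewrite HN, H1 by lia. ring. }
    destruct (Z_le_gt_dec r (Z.of_nat n)); [apply H1; lia | apply H2; unfold N in *; lia].
Qed.

(** * Integrals of piecewise continuous functions *)

(** The points at which every spline is differentiable, also for p = 1. *)
Definition nonknot (n : nat) (x : R) : Prop := forall i : Z, x <> IZR i * mesh n.

(** Each [q] is continuous on the whole line, so one-sided limits exist at the knots, while the
    values of [f] at the knots are left free. *)
Definition piecewise_continuous (n : nat) (f : R -> R) : Prop :=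
  forall i : Z, exists q, (forall x, continuous q x) /\
    forall x, IZR i * mesh n < x < IZR (i + 1) * mesh n -> f x = q x.

Lemma nonknot_cell n x : (1 <= n)%nat -> nonknot n x ->
  exists i, IZR i * mesh n < x < IZR (i + 1) * mesh n.
Proof.
  intros Hn Hx. pose proof (mesh_pos n Hn) as Hh.
  exists (Int_part ((x - 0) / mesh n)).
  pose proof (reduce_mod 0 (mesh n) x Hh) as H.
  pose proof (Hx (Int_part ((x - 0) / mesh n))).
  rewrite IZR_mesh_S. set (z := IZR (Int_part ((x - 0) / mesh n))) in *. lra.
Qed.

Lemma cell_nonknot n i x : (1 <= n)%nat ->
  IZR i * mesh n < x < IZR (i + 1) * mesh n -> nonknot n x.
Proof.
  intros Hn Hx k E. destruct (Z_le_gt_dec k i) as [H|H].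
  - pose proof (IZR_mesh_le n k i Hn H). lra.
  - pose proof (IZR_mesh_le n (i + 1) k Hn ltac:(lia)). lra.
Qed.

Lemma nonknot_opp n x : nonknot n x -> nonknot n (- x).
Proof.
  intros Hx i E. apply (Hx (- i)%Z). rewrite opp_IZR. lra.
Qed.

Lemma pwc_mult n f g : piecewise_continuous n f -> piecewise_continuous n g ->
  piecewise_continuous n (fun x => f x * g x).
Proof.
  intros Hf Hg i. destruct (Hf i) as [q [Hq E]], (Hg i) as [r [Hr E']].
  exists (fun x => q x * r x). split.
  - intros x. now apply @continuous_mult.
  - intros x Hx. now rewrite E, E'.
Qed.

Lemma pwc_plus n f g : piecewise_continuous n f -> piecewise_continuous n g ->
  piecewise_continuous n (fun x => f x + g x).
Proof.
  intros Hf Hg i. destruct (Hf i) as [q [Hq E]], (Hg i) as [r [Hr E']].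
  exists (fun x => q x + r x). split.
  - intros x. now apply @continuous_plus.
  - intros x Hx. now rewrite E, E'.
Qed.

Lemma pwc_const n a : piecewise_continuous n (fun _ => a).
Proof.
  intros i. exists (fun _ => a). split; [intros; apply continuous_const | reflexivity].
Qed.

Lemma pwc_lin n m c g :
  (forall j, (1 <= j <= m)%nat -> piecewise_continuous n (g j)) ->
  piecewise_continuous n (lin m c g).
Proof.
  induction m as [|m IH]; intros H.
  - intros i. exists (fun _ => 0). split; [intros; apply continuous_const|].
    intros; apply sum1_0.
  - assert (Hp : piecewise_continuous n (fun x => lin m c g x + c (S m) * g (S m) x)).
    { apply pwc_plus; [apply IH; intros; apply H; lia|].
      apply (pwc_mult n (fun _ => c (S m))); [apply pwc_const | apply H; lia]. }
    intros i. destruct (Hp i) as [q [Hq E]]. exists q. split; [exact Hq|].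
    intros x Hx. rewrite <- E by exact Hx. unfold lin. apply sum1_S.
Qed.

Lemma pwc_shift n f k : piecewise_continuous n f ->
  piecewise_continuous n (fun x => f (x + IZR k * mesh n)).
Proof.
  intros Hf i. destruct (Hf (i + k)%Z) as [q [Hq E]].
  exists (fun x => q (x + IZR k * mesh n)). split.
  - intros x. apply (continuous_comp (fun x => x + IZR k * mesh n) q); [|apply Hq].
    apply @continuous_plus; [apply continuous_id | apply continuous_const].
  - intros x Hx. apply E. rewrite !plus_IZR in *. lra.
Qed.

(** Proved cell by cell, because extensionality of [is_RInt] ignores the ends of an interval.
    Nothing is asked of [g] at the knots, so [g] may involve a [Derive] with arbitrary values
    there. *)
Lemma pwc_is_RInt n f g i m : (1 <= n)%nat -> piecewise_continuous n f ->
  (forall x, nonknot n x ->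
     IZR i * mesh n < x < IZR (i + Z.of_nat m) * mesh n -> g x = f x) ->
  is_RInt g (IZR i * mesh n) (IZR (i + Z.of_nat m) * mesh n)
    (RInt f (IZR i * mesh n) (IZR (i + Z.of_nat m) * mesh n)) /\
  ex_RInt f (IZR i * mesh n) (IZR (i + Z.of_nat m) * mesh n).
Proof.
  intros Hn Hf. pose proof (mesh_pos n Hn) as Hh.
  induction m as [|m IH]; intros H.
  - rewrite Z.add_0_r, RInt_point. split; [apply (is_RInt_point g) | apply ex_RInt_point].
  - replace (i + Z.of_nat (S m))%Z with (i + Z.of_nat m + 1)%Z in * by lia.
    set (k := (i + Z.of_nat m)%Z) in *.
    pose proof (IZR_mesh_S n k) as Hk.
    pose proof (IZR_mesh_le n i k Hn ltac:(lia)) as Hik.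
    destruct IH as [IH1 IH2]; [intros x Hx1 Hx2; apply H; [exact Hx1 | lra]|].
    destruct (Hf k) as [q [Hq E]].
    assert (Hex : ex_RInt f (IZR k * mesh n) (IZR (k + 1) * mesh n)).
    { apply ex_RInt_ext with q; [|apply (@ex_RInt_continuous R_CompleteNormedModule); auto].
      rewrite Rmin_left, Rmax_right by lra. intros x Hx. symmetry. now apply E. }
    split; [|now apply ex_RInt_Chasles with (IZR k * mesh n)].
    rewrite <- (RInt_Chasles f _ (IZR k * mesh n)) by assumption.
    apply (is_RInt_Chasles g _ (IZR k * mesh n)); [exact IH1|].
    apply is_RInt_ext with f; [|now apply (@RInt_correct R_CompleteNormedModule)].
    rewrite Rmin_left, Rmax_right by lra. intros x Hx. symmetry. apply H; [|lra].
    now apply (cell_nonknot n k).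
Qed.

Lemma pwc_ex_RInt n f i j : (1 <= n)%nat -> piecewise_continuous n f ->
  ex_RInt f (IZR i * mesh n) (IZR j * mesh n).
Proof.
  intros Hn Hf.
  assert (H : forall i j, (i <= j)%Z -> ex_RInt f (IZR i * mesh n) (IZR j * mesh n)).
  { intros a b Hab. replace b with (a + Z.of_nat (Z.to_nat (b - a)))%Z by lia.
    now apply (pwc_is_RInt n f f). }
  destruct (Z_le_gt_dec i j); [auto | apply ex_RInt_swap, H; lia].
Qed.

Lemma RInt_ext_nonknot n f g i j : (1 <= n)%nat -> (i <= j)%Z ->
  piecewise_continuous n f ->
  (forall x, nonknot n x -> IZR i * mesh n < x < IZR j * mesh n -> g x = f x) ->
  RInt g (IZR i * mesh n) (IZR j * mesh n) = RInt f (IZR i * mesh n) (IZR j * mesh n).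
Proof.
  intros Hn Hij Hf H. replace j with (i + Z.of_nat (Z.to_nat (j - i)))%Z in * by lia.
  apply is_RInt_unique. now apply pwc_is_RInt.
Qed.

Lemma RInt_ext_nonknot01 n f g : (1 <= n)%nat -> piecewise_continuous n f ->
  (forall x, nonknot n x -> 0 < x < 1 -> g x = f x) -> RInt g 0 1 = RInt f 0 1.
Proof.
  intros Hn Hf H. pose proof (mesh_mult n Hn) as Hm.
  pose proof (RInt_ext_nonknot n f g 0 (Z.of_nat n) Hn ltac:(lia) Hf) as E.
  rewrite Hm, Rmult_0_l in E. auto.
Qed.

Lemma pwc_ex_RInt01 n f : (1 <= n)%nat -> piecewise_continuous n f -> ex_RInt f 0 1.
Proof.
  intros Hn Hf. pose proof (pwc_ex_RInt n f 0 (Z.of_nat n) Hn Hf) as E.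
  now rewrite mesh_mult, Rmult_0_l in E.
Qed.

Lemma RInt_lin n f m c g : (1 <= n)%nat -> piecewise_continuous n f ->
  (forall j, (1 <= j <= m)%nat -> piecewise_continuous n (g j)) ->
  RInt (fun x => f x * lin m c g x) 0 1 =
  sum1 (fun j => c j * RInt (fun x => f x * g j x) 0 1) m.
Proof.
  intros Hn Hf. induction m as [|m IH]; intros Hg.
  - rewrite sum1_0. rewrite (RInt_ext _ (fun _ => 0)).
    + rewrite RInt_const. apply Rmult_0_r.
    + intros x _. unfold lin. rewrite sum1_0. apply Rmult_0_r.
  - rewrite sum1_S, <- IH by (intros; apply Hg; lia).
    assert (H1 : ex_RInt (fun x => f x * lin m c g x) 0 1).
    { apply (pwc_ex_RInt01 n); [exact Hn|]. apply pwc_mult; [exact Hf|].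
      apply pwc_lin. intros; apply Hg; lia. }
    assert (H2 : ex_RInt (fun x => f x * g (S m) x) 0 1).
    { apply (pwc_ex_RInt01 n); [exact Hn|]. apply pwc_mult; [exact Hf|]. apply Hg; lia. }
    rewrite (RInt_ext _ (fun x => f x * lin m c g x + c (S m) * (f x * g (S m) x))).
    + apply is_RInt_unique. apply (is_RInt_plus (V := R_NormedModule)).
      * now apply (@RInt_correct R_CompleteNormedModule).
      * apply (is_RInt_scal (V := R_NormedModule)).
        now apply (@RInt_correct R_CompleteNormedModule).
    + intros x _. unfold lin. rewrite sum1_S.
      match goal with |- @eq _ ?a ?b => change (@eq R a b) end. ring.
Qed.

(** The two intervals differ by end pieces that are translates of each other by the period 2.
    Translating by a multiple of h keeps all bounds at knots, where integrability is known. *)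
Lemma RInt_period_shift n P k : (1 <= n)%nat -> piecewise_continuous n P ->
  (forall x, P (x + 2) = P x) ->
  RInt (fun x => P (x + IZR k * mesh n)) (-1) 1 = RInt P (-1) 1.
Proof.
  intros Hn HP Hper. pose proof (mesh_mult n Hn) as Hm.
  assert (Hex : forall i j, ex_RInt P (IZR i * mesh n) (IZR j * mesh n))
    by (intros; now apply pwc_ex_RInt).
  assert (HA : IZR (- Z.of_nat n) * mesh n = -1) by (rewrite opp_IZR; lra).
  assert (HAk : IZR (- Z.of_nat n + k) * mesh n = -1 + IZR k * mesh n)
    by (rewrite plus_IZR; lra).
  assert (HBk : IZR (Z.of_nat n + k) * mesh n = 1 + IZR k * mesh n)
    by (rewrite plus_IZR; lra).
  pose proof (Hex (- Z.of_nat n)%Z (- Z.of_nat n + k)%Z) as E1.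
  pose proof (Hex (- Z.of_nat n + k)%Z (Z.of_nat n + k)%Z) as E2.
  pose proof (Hex (- Z.of_nat n)%Z (Z.of_nat n)%Z) as E3.
  pose proof (Hex (Z.of_nat n)%Z (Z.of_nat n + k)%Z) as E4.
  rewrite ?HA, ?HAk, ?HBk, ?Hm in *. set (v := IZR k * mesh n) in *.
  assert (Hcomp : forall a b w, ex_RInt P (a + w) (b + w) ->
    RInt (fun x => P (x + w)) a b = RInt P (a + w) (b + w)).
  { intros a b w Hab.
    pose proof (RInt_comp_lin P 1 w a b) as E. rewrite !Rmult_1_l in E.
    rewrite <- E by exact Hab. apply RInt_ext. intros x _.
    change (P (x + w) = 1 * P (1 * x + w)). now rewrite !Rmult_1_l. }
  rewrite Hcomp by exact E2.
  assert (Hend : RInt P 1 (1 + v) = RInt P (-1) (-1 + v)).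
  { replace 1 with (-1 + 2) at 1 by ring. replace (1 + v) with (-1 + v + 2) by ring.
    rewrite <- Hcomp; [apply RInt_ext; intros; apply Hper|].
    replace (-1 + 2) with 1 by ring. now replace (-1 + v + 2) with (1 + v) by ring. }
  pose proof (RInt_Chasles P _ _ _ E1 E2) as C1.
  pose proof (RInt_Chasles P _ _ _ E3 E4) as C2.
  rewrite <- C1, Hend in C2. unfold plus in C2; simpl in C2. lra.
Qed.

Lemma RInt_even01 n P : (1 <= n)%nat -> piecewise_continuous n P ->
  (forall x, nonknot n x -> P (- x) = P x) -> RInt P (-1) 1 = 2 * RInt P 0 1.
Proof.
  intros Hn HP Hev. pose proof (mesh_mult n Hn) as Hm.
  pose proof (pwc_ex_RInt n P (- Z.of_nat n) 0 Hn HP) as E1.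
  pose proof (pwc_ex_RInt01 n P Hn HP) as E2.
  rewrite opp_IZR, Rmult_0_l, Ropp_mult_distr_l_reverse, Hm in E1.
  pose proof (RInt_Chasles P _ _ _ E1 E2) as C. unfold plus in C; simpl in C.
  change (-1) with (- (1)). enough (RInt P (- (1)) 0 = RInt P 0 1) by lra.
  rewrite <- (RInt_ext_nonknot01 n P (fun x => P (- x)) Hn HP) by auto.
  assert (E0 : ex_RInt P (- 0) (- (1))) by (rewrite Ropp_0; now apply ex_RInt_swap).
  pose proof (is_RInt_comp_opp P 0 1 _ (@RInt_correct R_CompleteNormedModule _ _ _ E0)) as D.
  apply (is_RInt_opp (V := R_NormedModule)) in D.
  assert (D' : is_RInt (fun x => P (- x)) 0 1 (opp (RInt P (- 0) (- (1))))).
  { revert D. apply is_RInt_ext. intros x _. apply (opp_opp (G := R_AbelianGroup)). }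
  apply (is_RInt_unique (V := R_CompleteNormedModule)) in D'. rewrite D', Ropp_0.
  symmetry. apply opp_RInt_swap. now apply ex_RInt_swap.
Qed.

(* On 2-periodic functions the operator f(x + h) + f(x - h) is symmetric for
   the L2 product, so eigenfunctions for distinct eigenvalues are orthogonal. *)
Lemma shift_eigen_orthogonal n f g mu nu : (1 <= n)%nat ->
  piecewise_continuous n f -> piecewise_continuous n g ->
  (forall x, f (x + 2) = f x) -> (forall x, g (x + 2) = g x) ->
  (forall x, nonknot n x ->
     f (x + IZR 1 * mesh n) + f (x + IZR (-1) * mesh n) = mu * f x) ->
  (forall x, nonknot n x ->
     g (x + IZR 1 * mesh n) + g (x + IZR (-1) * mesh n) = nu * g x) ->
  (forall x, nonknot n x -> f (- x) * g (- x) = f x * g x) ->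
  mu <> nu -> RInt (fun x => f x * g x) 0 1 = 0.
Proof.
  intros Hn Hf Hg Pf Pg Ef Eg Hev Hne.
  pose proof (mesh_mult n Hn) as Hm.
  assert (HA : IZR (- Z.of_nat n) * mesh n = -1) by (rewrite opp_IZR; lra).
  pose (h := fun k => IZR k * mesh n).
  assert (Pf' : forall k x, f (x + 2 + h k) = f (x + h k)).
  { intros k x. rewrite <- (Pf (x + h k)). f_equal. ring. }
  assert (Pg' : forall k x, g (x + 2 + h k) = g (x + h k)).
  { intros k x. rewrite <- (Pg (x + h k)). f_equal. ring. }
  (* Translating the integration variable moves a shift from one factor to the other with opposite
     sign. *)
  assert (Hsw : forall k, RInt (fun x => f (x + h k) * g x) (-1) 1 =
                          RInt (fun x => f x * g (x + h (- k)%Z)) (-1) 1).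
  { intros k.
    rewrite <- (RInt_period_shift n (fun x => f x * g (x + h (- k)%Z)) k Hn).
    - apply RInt_ext. intros x _. fold (h k). f_equal. f_equal. unfold h.
      rewrite opp_IZR. ring.
    - apply pwc_mult; [exact Hf | now apply pwc_shift].
    - intros x. now rewrite Pf, Pg'. }
  assert (Hsum : forall u1 u2 v a,
    piecewise_continuous n u1 -> piecewise_continuous n u2 -> piecewise_continuous n v ->
    (forall x, nonknot n x -> u1 x + u2 x = a * v x) ->
    RInt u1 (-1) 1 + RInt u2 (-1) 1 = a * RInt v (-1) 1).
  { intros u1 u2 v a H1 H2 H3 E.
    pose proof (pwc_ex_RInt n u1 (- Z.of_nat n) (Z.of_nat n) Hn H1) as X1.
    pose proof (pwc_ex_RInt n u2 (- Z.of_nat n) (Z.of_nat n) Hn H2) as X2.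
    pose proof (pwc_ex_RInt n v (- Z.of_nat n) (Z.of_nat n) Hn H3) as X3.
    pose proof (RInt_ext_nonknot n (fun x => a * v x) (fun x => u1 x + u2 x)
      (- Z.of_nat n) (Z.of_nat n) Hn ltac:(lia)
      (pwc_mult n (fun _ => a) v (pwc_const n a) H3) (fun x Hx _ => E x Hx)) as X.
    rewrite HA, Hm in *.
    pose proof (RInt_plus u1 u2 (-1) 1 X1 X2) as Y1.
    pose proof (RInt_scal v (-1) 1 a X3) as Y2.
    unfold plus, scal in Y1, Y2; simpl in Y1, Y2. unfold mult in Y2; simpl in Y2.
    rewrite <- Y1, <- Y2. exact X. }
  set (I := RInt (fun x => f x * g x) (-1) 1).
  assert (H1 : RInt (fun x => f (x + h 1%Z) * g x) (-1) 1 +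
               RInt (fun x => f (x + h (-1)%Z) * g x) (-1) 1 = mu * I).
  { apply Hsum; try (apply pwc_mult; auto; now apply pwc_shift).
    intros x Hx. rewrite <- Rmult_plus_distr_r. unfold h. rewrite Ef by exact Hx. ring. }
  assert (H2 : RInt (fun x => f x * g (x + h 1%Z)) (-1) 1 +
               RInt (fun x => f x * g (x + h (-1)%Z)) (-1) 1 = nu * I).
  { apply Hsum; try (apply pwc_mult; auto; now apply pwc_shift).
    intros x Hx. rewrite <- Rmult_plus_distr_l. unfold h. rewrite Eg by exact Hx. ring. }
  (* The two sums now have the same terms in opposite order, hence [mu * I = nu * I]. *)
  rewrite !Hsw in H1. simpl in H1.
  assert (HI : I = 0).
  { assert ((mu - nu) * I = 0) by lra.
    destruct (Rmult_integral _ _ H); [lra | assumption]. }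
  (* Passing from a full period to [0, 1] needs only the product to be even: it serves two odd
     functions as well as their two even derivatives. *)
  unfold I in HI. rewrite (RInt_even01 n) in HI; [lra | exact Hn | now apply pwc_mult | exact Hev].
Qed.

(** * Integration and differentiation of splines *)

Lemma gspline_cell p n w i : (1 <= n)%nat -> gspline p n w ->
  exists q, poly_le p q /\
    forall x, IZR i * mesh n <= x <= IZR (i + 1) * mesh n -> w x = q x.
Proof.
  intros Hn [_ Hk]. destruct (Hk (i + 1)%Z) as [c [q [Hq [Hl _]]]].
  exists q. split; [exact Hq|]. intros x Hx. apply Hl.
  rewrite IZR_mesh_S in *. lra.
Qed.

Lemma gspline_pwc p n w : (1 <= n)%nat -> gspline p n w -> piecewise_continuous n w.
Proof.
  intros Hn Hw i. destruct (gspline_cell p n w i Hn Hw) as [q [Hq E]].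
  exists q. split; [intros; now apply (poly_continuous p) | intros; apply E; lra].
Qed.

Lemma gspline_Derive_pwc p n w :
  (1 <= n)%nat -> gspline p n w -> piecewise_continuous n (Derive w).
Proof.
  intros Hn Hw i. destruct (gspline_cell p n w i Hn Hw) as [q [Hq E]].
  exists (Derive q). split.
  - intros x. apply (poly_continuous (pred p)). now apply poly_Derive.
  - intros x Hx. apply Derive_ext_loc.
    apply (locally_Ioo (IZR i * mesh n) (IZR (i + 1) * mesh n)); [exact Hx|].
    intros y Hy. apply E. lra.
Qed.

Lemma gspline_ex_derive p n w x :
  (1 <= n)%nat -> gspline p n w -> nonknot n x -> ex_derive w x.
Proof.
  intros Hn Hw Hx. destruct (nonknot_cell n x Hn Hx) as [i Hi].
  destruct (gspline_cell p n w i Hn Hw) as [q [Hq E]].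
  apply ex_derive_ext_loc with q; [|now apply (poly_ex_derive p)].
  apply (locally_Ioo (IZR i * mesh n) (IZR (i + 1) * mesh n)); [exact Hi|].
  intros y Hy. symmetry. apply E. lra.
Qed.

Lemma Derive_shift w a x : Derive (fun y => w (y + a)) x = Derive w (x + a).
Proof. exact (Derive_n_comp_trans w 1 x a). Qed.

Lemma Derive_lin m c g x : (forall j, (1 <= j <= m)%nat -> ex_derive (g j) x) ->
  Derive (lin m c g) x = lin m c (fun j => Derive (g j)) x.
Proof.
  intros H. apply is_derive_unique. induction m as [|m IH].
  - apply is_derive_ext with (fun _ => 0); [intros; symmetry; apply sum1_0|].
    unfold lin. rewrite sum1_0. apply @is_derive_const.
  - apply is_derive_ext with (fun y => lin m c g y + c (S m) * g (S m) y);
      [intros; symmetry; unfold lin; apply sum1_S|].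
    replace (lin (S m) c (fun j => Derive (g j)) x)
      with (lin m c (fun j => Derive (g j)) x + c (S m) * Derive (g (S m)) x)
      by (symmetry; unfold lin; apply (sum1_S (fun j => c j * Derive (g j) x))).
    apply @is_derive_plus; [apply IH; intros; apply H; lia|].
    apply is_derive_scal, Derive_correct, H. lia.
Qed.

(** [x0] may be an end point: for odd p the first positive node is the right end of the first
    cell. *)
Lemma RInt_sq_pos q a b x0 : (forall x, continuous q x) -> a < b -> a <= x0 <= b ->
  q x0 <> 0 -> 0 < RInt (fun x => q x * q x) a b.
Proof.
  intros Hq Hab Hx0 Hne.
  assert (Hc : forall x, continuous (fun x => q x * q x) x)
    by (intros; now apply @continuous_mult).
  assert (Hex : forall u v, ex_RInt (fun x => q x * q x) u v)
    by (intros; apply (@ex_RInt_continuous R_CompleteNormedModule); auto).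
  assert (Hloc : locally x0 (fun x => q x <> 0)).
  { refine (Hq x0 (fun y => y <> 0) _). exists (mkposreal _ (Rabs_pos_lt _ Hne)). intros y Hy E. rewrite E in Hy.
    change (Rabs (0 - q x0) < Rabs (q x0)) in Hy.
    rewrite Rminus_0_l, Rabs_Ropp in Hy. lra. }
  destruct Hloc as [eps He].
  (* A neighbourhood of [x0] cut down to [a, b]; it keeps positive length even when [x0] is an
     end. *)
  pose (u := Rmax a (x0 - eps / 2)). pose (v := Rmin b (x0 + eps / 2)).
  pose proof (cond_pos eps) as Hp.
  assert (Hu : a <= u /\ x0 - eps / 2 <= u) by (split; [apply Rmax_l | apply Rmax_r]).
  assert (Hv : v <= b /\ v <= x0 + eps / 2) by (split; [apply Rmin_l | apply Rmin_r]).
  assert (Huv : u < v) by (unfold u, v; apply Rmax_case; apply Rmin_case; lra).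
  assert (Hge : forall s t, s <= t -> 0 <= RInt (fun x => q x * q x) s t).
  { intros s t Hst. apply RInt_ge_0; [exact Hst | apply Hex|].
    intros x _. apply Rle_0_sqr. }
  pose proof (RInt_Chasles _ a u b (Hex a u) (Hex u b)) as C1.
  pose proof (RInt_Chasles _ u v b (Hex u v) (Hex v b)) as C2.
  unfold plus in C1, C2; simpl in C1, C2.
  assert (0 < RInt (fun x => q x * q x) u v).
  { apply RInt_gt_0; [exact Huv | | auto].
    intros x Hx. apply Rsqr_pos_lt. apply He.
    change (Rabs (x - x0) < eps). apply Rabs_def1; lra. }
  pose proof (Hge a u ltac:(lra)). pose proof (Hge v b ltac:(lra)). lra.
Qed.

(** * The eigenbasis *)

(** The first positive node x lies in the first cell and j pi x in (0, pi), so sin(j pi x) > 0. For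
    odd p this is j h < 1, which needs j <= n - 1; for even p, j h / 2 <= 1/2. *)
Lemma nreg_node p n j : (1 <= n)%nat -> (1 <= j <= nreg p n)%nat ->
  0 <= node p n 1 <= mesh n /\ 0 < node p n 1 * INR j < 1.
Proof.
  intros Hn Hj. pose proof (mesh_pos n Hn) as Hh. pose proof (mesh_mult n Hn) as Hm.
  assert (Hj1 : 1 <= INR j) by (apply (le_INR 1); lia).
  rewrite <- INR_IZR_INZ in Hm.
  assert (Hlt : forall k, (k < n)%nat -> mesh n * INR k < 1).
  { intros k Hk. rewrite <- Hm, Rmult_comm. apply Rmult_lt_compat_r; [lra|].
    now apply lt_INR. }
  assert (Hpos : 0 < mesh n * INR j) by (apply Rmult_lt_0_compat; lra).
  rewrite node_eq. unfold nreg, node_offset in *. destruct (Nat.odd p).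
  - specialize (Hlt j ltac:(lia)). split; lra.
  - assert (mesh n * INR j <= mesh n * INR n).
    { apply Rmult_le_compat_l; [lra|]. apply le_INR. lia. }
    split; lra.
Qed.

Lemma cos_mesh_inj p n i j : (1 <= n)%nat ->
  (1 <= i <= nreg p n)%nat -> (1 <= j <= nreg p n)%nat -> i <> j ->
  2 * cos (mesh n * (INR i * PI)) <> 2 * cos (mesh n * (INR j * PI)).
Proof.
  intros Hn Hi Hj Hne E.
  pose proof (mesh_pos n Hn) as Hh. pose proof (mesh_mult n Hn) as Hm.
  rewrite <- INR_IZR_INZ in Hm. pose proof PI_RGT_0 as HPI.
  pose proof (nreg_le p n) as Hle.
  assert (Hr : forall k, (k <= n)%nat -> 0 <= mesh n * (INR k * PI) <= PI).
  { intros k Hk. pose proof (pos_INR k) as H0.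
    assert (INR k * mesh n <= INR n * mesh n)
      by (apply Rmult_le_compat_r; [lra | now apply le_INR]).
    assert (0 <= INR k * mesh n) by (apply Rmult_le_pos; lra).
    replace (mesh n * (INR k * PI)) with (INR k * mesh n * PI) by ring.
    split; [apply Rmult_le_pos; lra|].
    rewrite <- (Rmult_1_l PI) at 2. apply Rmult_le_compat_r; lra. }
  apply Hne, INR_eq.
  apply (Rmult_eq_reg_r PI); [|lra]. apply (Rmult_eq_reg_l (mesh n)); [|lra].
  apply cos_inj; [apply Hr; lia | apply Hr; lia | lra].
Qed.

Lemma fourier_per_Derive_even p n L j x : (1 <= p)%nat -> (1 <= n)%nat ->
  lagrange_basis p n L -> nonknot n x ->
  Derive (fourier_per p n L j) (- x) = Derive (fourier_per p n L j) x.
Proof.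
  intros Hp Hn HL Hx.
  assert (E : Derive (fun y => fourier_per p n L j (- y)) x =
              Derive (fun y => - fourier_per p n L j y) x)
    by (apply Derive_ext; intros; now apply fourier_per_odd).
  rewrite Derive_opp, Derive_comp, Derive_opp, Derive_id in E; [lra| |].
  - apply (gspline_ex_derive p n); [exact Hn | now apply fourier_per_gspline|].
    now apply nonknot_opp.
  - apply @ex_derive_opp, ex_derive_id.
Qed.

Lemma fourier_per_Derive_shift p n L j x : (1 <= p)%nat -> (1 <= n)%nat ->
  lagrange_basis p n L -> nonknot n x ->
  Derive (fourier_per p n L j) (x + IZR 1 * mesh n) +
  Derive (fourier_per p n L j) (x + IZR (-1) * mesh n) =
  2 * cos (mesh n * (INR j * PI)) * Derive (fourier_per p n L j) x.
Proof.
  intros Hp Hn HL Hx.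
  pose proof (fourier_per_gspline p n L j Hp Hn HL) as HG.
  rewrite <- !Derive_shift, <- Derive_plus, <- Derive_scal.
  - apply Derive_ext. intros y. now apply fourier_per_shift.
  - apply (gspline_ex_derive p n); [exact Hn | now apply gspline_shift | exact Hx].
  - apply (gspline_ex_derive p n); [exact Hn | now apply gspline_shift | exact Hx].
Qed.

Lemma fourier_per_orthogonal p n L i j : (1 <= p)%nat -> (1 <= n)%nat ->
  lagrange_basis p n L ->
  (1 <= i <= nreg p n)%nat -> (1 <= j <= nreg p n)%nat -> i <> j ->
  RInt (fun x => fourier_per p n L i x * fourier_per p n L j x) 0 1 = 0 /\
  RInt (fun x => Derive (fourier_per p n L i) x * Derive (fourier_per p n L j) x) 0 1 = 0.
Proof.
  intros Hp Hn HL Hi Hj Hne.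
  pose proof (cos_mesh_inj p n i j Hn Hi Hj Hne) as Hmu.
  assert (HG : forall k, gspline p n (fourier_per p n L k))
    by (intros; now apply fourier_per_gspline).
  split; (eapply shift_eigen_orthogonal; [exact Hn| | | | | | | |exact Hmu]).
  - now apply (gspline_pwc p).
  - now apply (gspline_pwc p).
  - intros x. now apply fourier_per_periodic2.
  - intros x. now apply fourier_per_periodic2.
  - intros x _. now apply fourier_per_shift.
  - intros x _. now apply fourier_per_shift.
  - intros x _. rewrite !fourier_per_odd by assumption. ring.
  - now apply (gspline_Derive_pwc p).
  - now apply (gspline_Derive_pwc p).
  - intros x. rewrite <- Derive_shift. apply Derive_ext. intros; now apply fourier_per_periodic2.
  - intros x. rewrite <- Derive_shift. apply Derive_ext. intros; now apply fourier_per_periodic2.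
  - intros x Hx. now apply fourier_per_Derive_shift.
  - intros x Hx. now apply fourier_per_Derive_shift.
  - intros x Hx. now rewrite !fourier_per_Derive_even.
Qed.

(** The first cell already contributes a positive amount, as it contains a node where the function
    is nonzero. *)
Lemma fourier_per_mass_pos p n L j : (1 <= p)%nat -> (1 <= n)%nat ->
  lagrange_basis p n L -> (1 <= j <= nreg p n)%nat ->
  0 < RInt (fun x => fourier_per p n L j x * fourier_per p n L j x) 0 1.
Proof.
  intros Hp Hn HL Hj.
  pose proof (fourier_per_gspline p n L j Hp Hn HL) as HG.
  destruct (nreg_node p n j Hn Hj) as [Hx Hs].
  pose proof (mesh_pos n Hn) as Hh. pose proof (mesh_mult n Hn) as Hm.
  pose proof (gspline_pwc p n _ Hn HG) as HP.
  pose proof (pwc_mult n _ _ HP HP) as HP2.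
  destruct (gspline_cell p n _ 0 Hn HG) as [q [Hq E]].
  rewrite IZR_mesh_S, Rmult_0_l, Rplus_0_l in E.
  pose proof (pwc_ex_RInt n _ 0 1 Hn HP2) as E1.
  pose proof (pwc_ex_RInt n _ 1 (Z.of_nat n) Hn HP2) as E2.
  rewrite Hm, Rmult_0_l, Rmult_1_l in *.
  pose proof (RInt_Chasles _ _ _ _ E1 E2) as C. unfold plus in C; simpl in C.
  assert (0 < RInt (fun x => fourier_per p n L j x * fourier_per p n L j x) 0 (mesh n)).
  { rewrite (RInt_ext _ (fun x => q x * q x)).
    - apply (RInt_sq_pos q 0 (mesh n) (node p n 1)); [|exact Hh|exact Hx|].
      + intros; now apply (poly_continuous p).
      + rewrite <- E, fourier_per_node by assumption.
        pose proof PI_RGT_0 as HPI. rewrite <- Rmult_assoc.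
        apply Rgt_not_eq, sin_gt_0; [apply Rmult_lt_0_compat; lra|].
        rewrite <- (Rmult_1_l PI) at 2. apply Rmult_lt_compat_r; lra.
    - rewrite Rmin_left, Rmax_right by lra. intros x Hx'. now rewrite !E by lra. }
  assert (mesh n <= 1).
  { pose proof (IZR_mesh_le n 1 (Z.of_nat n) Hn ltac:(lia)). lra. }
  assert (0 <= RInt (fun x => fourier_per p n L j x * fourier_per p n L j x) (mesh n) 1).
  { apply RInt_ge_0; [assumption | exact E2|]. intros; apply Rle_0_sqr. }
  lra.
Qed.

(** Smoothness comes from the Lagrange functions. Oddness at 0, and oddness with period 2 at 1, make
    the two pieces at each end half-turns of one another, so [reflect_flat] yields the vanishing
    even derivatives. *)
Lemma fourier_spline_reg p n L j : (1 <= p)%nat -> (1 <= n)%nat ->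
  lagrange_basis p n L -> spline_reg p n (fourier p n L j).
Proof.
  intros Hp Hn HL.
  pose proof (fourier_per_gspline p n L j Hp Hn HL) as HG.
  pose proof (mesh_pos n Hn) as Hh. pose proof (mesh_mult n Hn) as Hm.
  pose proof (fun x => fourier_per_odd p n L j x Hp Hn HL) as Hodd.
  pose proof (fun x => fourier_per_periodic2 p n L j x Hp Hn HL) as Hper.
  assert (HE : forall x, -2 <= x <= 2 -> fourier p n L j x = fourier_per p n L j x)
    by (intros; symmetry; now apply fourier_per_eq).
  set (G := fourier_per p n L j) in *.
  assert (Hmle : mesh n <= 1).
  { pose proof (IZR_mesh_le n 1 (Z.of_nat n) Hn ltac:(lia)). lra. }
  assert (HC : Ck_on (-2) 2 (p - 1) (fourier p n L j)).
  { apply (Ck_on_lin (-2) 2 (p - 1) (4 * n)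
      (fun m => sin (node p n (Z.of_nat m - 2 * Z.of_nat n) * (INR j * PI)))
      (fun m => L (Z.of_nat m - 2 * Z.of_nat n)%Z)).
    intros m Hmn. destruct (HL (Z.of_nat m - 2 * Z.of_nat n)%Z) as [[[d [Hd _]] _] _];
      [unfold node_index; lia|]. now exists d. }
  destruct HC as [d Hd].
  apply (derivs_on_mono _ _ 0 1) in Hd; [|lra|lra].
  split; [split; [now exists d | split; [|split]]|].
  - intros k Hk. destruct (gspline_cell p n G (Z.of_nat k - 1) Hn HG) as [q [Hq E]].
    replace (Z.of_nat k - 1 + 1)%Z with (Z.of_nat k) in E by ring.
    exists q. split; [exact Hq|]. intros x. unfold seg.
    rewrite !INR_IZR_INZ, Nat2Z.inj_sub by lia. intros Hx.
    pose proof (IZR_mesh_le n 0 (Z.of_nat k - 1) Hn ltac:(lia)).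
    pose proof (IZR_mesh_le n (Z.of_nat k) (Z.of_nat n) Hn ltac:(lia)).
    rewrite HE; [apply E; exact Hx|]. simpl in Hx. lra.
  - rewrite HE by lra. specialize (Hodd 0). rewrite Ropp_0 in Hodd. lra.
  - rewrite HE by lra. specialize (Hodd 1). specialize (Hper (- (1))).
    replace (- (1) + 2) with 1 in Hper by ring. lra.
  - exists d. split; [exact Hd|]. intros k Hk.
    pose proof (Nat.Div0.mul_div_le (p - 1) 2) as Hdiv.
    split.
    + destruct (proj2 HG 0%Z) as [c [q0 [Hq0 [Hl Hr]]]].
      rewrite Rmult_0_l in Hl, Hr.
      pose (q := fun x => q0 x + c * (1 * x + - 0) ^ p).
      assert (Hq : poly_le p q)
        by (apply poly_le_plus; [exact Hq0 | apply poly_le_scal, poly_le_pow_affine]).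
      assert (Eq : forall x, q x = q0 x + c * (x - 0) ^ p)
        by (intros; unfold q; now rewrite Rmult_1_l).
      (* [q] is the piece to the right of 0; its half-turn is the left piece [q0], so the jump
         passed to [reflect_flat] is [- c]. *)
      assert (Erefl : forall x, - q (2 * 0 - x) = q0 x).
      { apply (poly_eq p _ _ (- mesh n) 0); [now apply poly_le_reflect | exact Hq0 | lra|].
        intros x Hx. rewrite Eq, <- Hr, <- Hl by lra.
        replace (2 * 0 - x) with (- x) by ring. rewrite Hodd. ring. }
      rewrite (derivs_on_poly p 0 1 (p - 1) _ d q 0 (mesh n) Hd Hq);
        [|lra|lra|lra| |lia|lra].
      * apply (reflect_flat p q 0 (- c) Hq); [|lia].
        intros x. rewrite Erefl, Eq. ring.
      * intros x Hx. rewrite HE, Eq by lra. apply Hr. lra.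
    + destruct (proj2 HG (Z.of_nat n)) as [c [q [Hq [Hl Hr]]]].
      rewrite Hm in Hl, Hr.
      rewrite (derivs_on_poly p 0 1 (p - 1) _ d q (1 - mesh n) 1 Hd Hq);
        [|lra|lra|lra| |lia|lra].
      * apply (reflect_flat p q 1 c Hq); [|lia].
        intros x. rewrite <- (Rmult_1_l (x - 1)). unfold Rminus at 2. rewrite Rmult_plus_distr_l.
        replace (1 * - (1)) with (- (1)) by ring.
        revert x. apply (poly_eq p _ _ 1 (1 + mesh n)); [now apply poly_le_reflect| |lra|].
        { apply poly_le_plus; [exact Hq | apply poly_le_scal, poly_le_pow_affine]. }
        intros x Hx. rewrite Rmult_1_l. change (x + - (1)) with (x - 1).
        rewrite <- Hr, <- Hl by lra. rewrite <- Hodd, <- Hper. f_equal. ring.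
      * intros x Hx. rewrite HE by lra. apply Hl. lra.
Qed.

(** Integrating the relation against the k-th function leaves only the term [c k] times a positive
    number. *)
Lemma fourier_per_independent p n L c : (1 <= p)%nat -> (1 <= n)%nat ->
  lagrange_basis p n L ->
  (forall x, 0 < x < 1 -> lin (nreg p n) c (fourier_per p n L) x = 0) ->
  forall k, (1 <= k <= nreg p n)%nat -> c k = 0.
Proof.
  intros Hp Hn HL H k Hk.
  assert (HP : forall j, piecewise_continuous n (fourier_per p n L j)).
  { intros j. apply (gspline_pwc p); [exact Hn | now apply fourier_per_gspline]. }
  pose proof (RInt_lin n (fourier_per p n L k) (nreg p n) c _ Hn (HP k) (fun j _ => HP j)) as E.
  rewrite (sum1_single _ _ k Hk) in E.
  - rewrite (RInt_ext _ (fun _ => 0)) in E.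
    + rewrite RInt_const in E.
      pose proof (fourier_per_mass_pos p n L k Hp Hn HL Hk) as Hpos.
      assert (E0 : c k * RInt (fun x => fourier_per p n L k x * fourier_per p n L k x) 0 1 = 0).
      { rewrite <- E. apply Rmult_0_r. }
      destruct (Rmult_integral _ _ E0); [assumption | lra].
    + rewrite Rmin_left, Rmax_right by lra. intros x Hx. rewrite H by exact Hx. apply Rmult_0_r.
  - intros j Hj Hne.
    rewrite (proj1 (fourier_per_orthogonal p n L k j Hp Hn HL Hk Hj (not_eq_sym Hne))). ring.
Qed.

(** Together with the odd extension of [v] there are nreg + 1 odd 2-periodic splines, sampled at
    nreg nodes. Some nontrivial combination vanishes at these nodes and hence everywhere;
    independence of the [F j] makes the coefficient of [v] nonzero. *)
Lemma spline_reg_expansion p n L v : (1 <= p)%nat -> (1 <= n)%nat ->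
  lagrange_basis p n L -> spline_reg p n v ->
  exists c, forall x, 0 <= x <= 1 -> v x = lin (nreg p n) c (fourier_per p n L) x.
Proof.
  intros Hp Hn HL Hv.
  pose proof Hv as [[_ [_ [v0 v1]]] _].
  pose proof (spline_reg_gspline p n v Hp Hn Hv) as Hw.
  assert (HG : forall k, gspline p n (fourier_per p n L k))
    by (intros; now apply fourier_per_gspline).
  set (m := nreg p n).
  pose (f := fun j => if Nat.eq_dec j (S m) then odd_ext v else fourier_per p n L j).
  assert (Hlast : f (S m) = odd_ext v).
  { unfold f. destruct (Nat.eq_dec (S m) (S m)); [reflexivity | lia]. }
  assert (Hfirst : forall j, (1 <= j <= m)%nat -> f j = fourier_per p n L j).
  { intros j Hj. unfold f. destruct (Nat.eq_dec j (S m)); [lia | reflexivity]. }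
  assert (Hf : forall j, gspline p n (f j) /\ (forall x, f j (- x) = - f j x) /\
                         (forall x, f j (x + 2) = f j x)).
  { intros j. unfold f. destruct (Nat.eq_dec j (S m)); repeat split; try apply Hw; try apply HG.
    - intros x. now apply odd_ext_odd.
    - intros x. apply odd_ext_periodic.
    - intros x. now apply fourier_per_odd.
    - intros x. now apply fourier_per_periodic2. }
  destruct (linear_dependence m (fun j i => f j (node p n (Z.of_nat i))))
    as [b [[j0 [Hj0 Hb0]] Hb]].
  pose proof (gspline_lin p n (S m) b f (fun j _ => proj1 (Hf j))) as HW.
  assert (Hzero : forall i, lin (S m) b f (node p n i) = 0).
  { apply odd_periodic_nodes; [exact Hn | | |exact Hb].
    - intros x. replace (- lin (S m) b f x) with (-1 * lin (S m) b f x) by ring.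
      unfold lin. rewrite <- sum1_scal. apply sum1_ext. intros j _. rewrite (proj1 (proj2 (Hf j))). ring.
    - intros x. apply sum1_ext. intros j _. now rewrite (proj2 (proj2 (Hf j))). }
  assert (HW0 : forall x, lin (S m) b f x = 0).
  { intros x. rewrite <- (Rmult_0_l (lin (S m) b f x)).
    apply (gspline_eq p n L (lin (S m) b f) (fun x => 0 * lin (S m) b f x) Hp Hn HL);
      [exact HW | now apply gspline_scal|].
    intros i. rewrite Hzero. ring. }
  assert (Hsplit : forall x,
    lin m b (fourier_per p n L) x + b (S m) * odd_ext v x = 0).
  { intros x. rewrite <- (HW0 x), <- Hlast. unfold lin. rewrite sum1_S. f_equal.
    apply sum1_ext. intros j Hj. now rewrite Hfirst. }
  assert (Hne : b (S m) <> 0).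
  { intros Hz. destruct (Nat.eq_dec j0 (S m)) as [->|Hj]; [contradiction|].
    apply Hb0. apply (fourier_per_independent p n L b Hp Hn HL); [|fold m; lia].
    intros x _. specialize (Hsplit x). rewrite Hz in Hsplit. fold m. lra. }
  exists (fun j => - / b (S m) * b j). intros x Hx.
  rewrite <- odd_ext_pos by assumption.
  replace (lin m (fun j => - / b (S m) * b j) (fourier_per p n L) x)
    with (- / b (S m) * lin m b (fourier_per p n L) x).
  - apply (Rmult_eq_reg_l (b (S m))); [|exact Hne].
    rewrite <- Rmult_assoc, <- Ropp_mult_distr_r, Rinv_r by exact Hne.
    specialize (Hsplit x). lra.
  - unfold lin. rewrite <- sum1_scal. apply sum1_ext. intros; ring.
Qed.

Theorem theorem3 :
  forall (p n : nat) (L : Z -> R -> R),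
    (1 <= p)%nat -> (1 <= n)%nat ->
    lagrange_basis p n L ->
    let F := fourier p n L in
    basis_on 0 1 (spline_reg p n) (nreg p n) F /\
    (forall i j : nat,
       (1 <= i <= nreg p n)%nat -> (1 <= j <= nreg p n)%nat -> i <> j ->
       mass (F i) (F j) = 0 /\ stiffness (F i) (F j) = 0) /\
    (forall j : nat, (1 <= j <= nreg p n)%nat ->
       exists lambda : R, forall v : R -> R, spline_reg p n v ->
         stiffness (F j) v = lambda * mass (F j) v).
Proof.
  intros p n L Hp Hn HL F.
  set (G := fourier_per p n L).
  assert (HG : forall k, gspline p n (G k))
    by (intros; now apply fourier_per_gspline).
  assert (HFG : forall j x, -2 <= x <= 2 -> F j x = G j x)
    by (intros; symmetry; now apply fourier_per_eq).
  assert (HP : forall j, piecewise_continuous n (G j))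
    by (intros; now apply (gspline_pwc p)).
  assert (HDP : forall j, piecewise_continuous n (Derive (G j)))
    by (intros; now apply (gspline_Derive_pwc p)).
  assert (HlinFG : forall c x, seg 0 1 x ->
    sum_n_m (fun j => c j * F j x) 1 (nreg p n) = lin (nreg p n) c G x).
  { intros c x Hx. apply sum1_ext. intros j _. rewrite HFG; [reflexivity|].
    unfold seg in Hx. lra. }
  assert (HDF : forall j x, 0 < x < 1 -> Derive (F j) x = Derive (G j) x).
  { intros j x Hx. apply Derive_ext_loc. apply (locally_Ioo 0 1); [exact Hx|].
    intros y Hy. apply HFG. lra. }
  (* By orthogonality either form against [F j] reads off one coordinate of [v]. Both the
     orthogonality and the eigenvalue claims are instances. *)
  assert (Hforms : forall j v c, (1 <= j <= nreg p n)%nat ->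
    (forall x, 0 <= x <= 1 -> v x = lin (nreg p n) c G x) ->
    mass (F j) v = c j * RInt (fun x => G j x * G j x) 0 1 /\
    stiffness (F j) v = c j * RInt (fun x => Derive (G j) x * Derive (G j) x) 0 1).
  { intros j v c Hj Hv. split.
    - unfold mass. rewrite (RInt_ext_nonknot01 n (fun x => G j x * lin (nreg p n) c G x)).
      + rewrite (RInt_lin n) by auto. rewrite (sum1_single _ _ j Hj); [reflexivity|].
        intros i Hi Hne. unfold G.
        rewrite (proj1 (fourier_per_orthogonal p n L j i Hp Hn HL Hj Hi (not_eq_sym Hne))). ring.
      + exact Hn.
      + apply pwc_mult; [apply HP | apply pwc_lin; auto].
      + intros x _ Hx. rewrite HFG, Hv by lra. reflexivity.
    - unfold stiffness. rewrite (RInt_ext_nonknot01 n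
        (fun x => Derive (G j) x * lin (nreg p n) c (fun i => Derive (G i)) x)).
      + rewrite (RInt_lin n) by auto. rewrite (sum1_single _ _ j Hj); [reflexivity|].
        intros i Hi Hne. unfold G.
        rewrite (proj2 (fourier_per_orthogonal p n L j i Hp Hn HL Hj Hi (not_eq_sym Hne))). ring.
      + exact Hn.
      + apply pwc_mult; [apply HDP | apply pwc_lin; auto].
      (* [v] is known only on [0, 1], so [Derive v] is controlled only in the interior, and off the
         knots for the termwise derivative. *)
      + intros x Hk Hx. rewrite HDF by exact Hx. f_equal.
        rewrite <- Derive_lin.
        * apply Derive_ext_loc. apply (locally_Ioo 0 1); [exact Hx|].
          intros y Hy. apply Hv. lra.
        * intros i _. now apply (gspline_ex_derive p n). }
  split; [split; [|split]|split].
  - intros j _. now apply fourier_spline_reg.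
  - intros c Hc. apply (fourier_per_independent p n L c Hp Hn HL).
    intros x Hx. fold G. rewrite <- HlinFG by (unfold seg; lra). apply Hc. unfold seg. lra.
  - intros v Hv. destruct (spline_reg_expansion p n L v Hp Hn HL Hv) as [c Hc].
    exists c. intros x Hx. rewrite HlinFG by exact Hx. now apply Hc.
  - intros i j Hi Hj Hne.
    (* [F j] is its own expansion, with the j-th unit vector as coordinates. *)
    destruct (Hforms i (F j) (fun k => if Nat.eq_dec k j then 1 else 0) Hi) as [H1 H2].
    { intros x Hx. unfold lin. rewrite (sum1_single _ _ j Hj).
      - destruct (Nat.eq_dec j j); [|lia]. rewrite HFG by lra. ring.
      - intros k _ Hk. destruct (Nat.eq_dec k j); [lia | ring]. }
    cbv beta in H1, H2. destruct (Nat.eq_dec i j); [contradiction|].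
    rewrite H1, H2. split; ring.
  - intros j Hj.
    pose proof (fourier_per_mass_pos p n L j Hp Hn HL Hj) as Hpos. fold G in Hpos.
    (* The eigenvalue is the Rayleigh quotient of [F j]. *)
    exists (RInt (fun x => Derive (G j) x * Derive (G j) x) 0 1 /
            RInt (fun x => G j x * G j x) 0 1).
    intros v Hv. destruct (spline_reg_expansion p n L v Hp Hn HL Hv) as [c Hc].
    destruct (Hforms j v c Hj Hc) as [H1 H2]. rewrite H1, H2. field. lra.
Qed.
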